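(* Let $n\ge 1$, $m=n(n+1)/2$, $\ell\geq m$, and let $R_1,\ldots,R_\ell\in SPD(n)$. Let $F:SPD(n)\to\mathbb{R}^\ell$ be given by $F(P)=(d(R_1,P)^2,\ldots,d(R_\ell,P)^2)$. Suppose there exists $Q\in SPD(n)$ such that the family $\{\log_Q R_1,\ldots,\log_Q R_\ell\}$ has rank $m$ (i.e. spans $Sym(n)$). Then the set $$S_{R_1,\ldots,R_\ell}=\{P\in SPD(n):\operatorname{rank}(\log_P R_1,\ldots,\log_P R_\ell)<m\}$$ has Lebesgue measure zero in $SPD(n)$. In other words, $F$ is locally invertible on the open subset $\Gamma_{R_1,\ldots,R_\ell}=SPD(n)\setminus S_{R_1,\ldots,R_\ell}$, which has full measure in $SPD(n)$.
   Context: $Sym(n)$ is the $m$-dimensional real vector space of real symmetric $n\times n$ matrices and $SPD(n)\subset Sym(n)$ the open subset of positive definite ones (with Lebesgue measure induced from $Sym(n)\cong\mathbb{R}^m$). $SPD(n)$ is equipped with the affine-invariant Riemannian metric $\langle V,W\rangle_P=\operatorname{Tr}(P^{-1}VP^{-1}W)$ for $V,W\in T_PSPD(n)\cong Sym(n)$. Its Riemannian distance is $d(P,Q)=\left(\operatorname{Tr}\big(\log(P^{-1/2}QP^{-1/2})^2\big)\right)^{1/2}$, and its Riemannian logarithm is $\log_P(Q)=P^{1/2}\log(P^{-1/2}QP^{-1/2})P^{1/2}\in Sym(n)$, where $\log$ without subscript is the matrix logarithm. $\operatorname{rank}(\log_P R_1,\ldots,\log_P R_\ell)$ is the dimension of the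 linear span of these matrices in $Sym(n)$. $F$ is called locally invertible at $P$ if its differential $DF(P)$ has rank $m$ (so that $F$ is a diffeomorphism from a neighborhood of $P$ onto the image of that neighborhood). *)

(* Defs.v *)
(* Classical mathematics over an arbitrary realType, with MathComp-Analysis. *)
From HB Require Import structures.
From mathcomp Require Import all_boot all_order all_algebra.
From mathcomp Require Import all_classical all_reals all_analysis.
Set Implicit Arguments.
Unset Strict Implicit.
Unset Printing Implicit Defensive.
Import Order.TTheory GRing.Theory Num.Theory.
Import numFieldNormedType.Exports.
Local Open Scope classical_set_scope.
Local Open Scope ring_scope.

Definition symdim (n : nat) : nat := (n * n.+1)./2.

Lemma sum_symdim n : (\sum_(j < n) j.+1)%N = symdim n.
Proof.
rewrite /symdim; elim: n => [|k IH]; first by rewrite big_ord0.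
rewrite big_ord_recr IH.
have -> : (k.+1 * k.+2 = k * k.+1 + k.+1.*2)%N.
  by rewrite -muln2 [(k * _)%N]mulnC -mulnDr addn2.
by rewrite halfD odd_double andbF add0n doubleK.
Qed.

(* The coordinates of a symmetric matrix are its entries (i, j) with i <= j,
   enumerated by [uidx : 'I_(symdim n) -> 'I_n * 'I_n]. *)
Section UpperIndices.
Variable n : nat.

Definition upper : {set 'I_n * 'I_n} :=
  [set p : 'I_n * 'I_n | (nat_of_ord p.1 <= nat_of_ord p.2)%N].

Lemma card_upper : #|upper| = symdim n.
Proof.
rewrite -sum1_card (eq_bigl (fun p : 'I_n * 'I_n => true && (p.1 <= p.2)%N));
  last by move=> p; rewrite inE.
rewrite -(pair_big_dep predT (fun i j : 'I_n => (i <= j)%N) (fun _ _ => 1%N)) /=.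
rewrite (exchange_big_dep predT) //=.
transitivity (\sum_(j < n) j.+1)%N.
  apply: eq_bigr => j _.
  by rewrite -(big_ord_widen _ (fun=> 1%N) (ltn_ord j)) sum1_card card_ord.
exact: sum_symdim.
Qed.

Definition uidx (k : 'I_(symdim n)) : 'I_n * 'I_n :=
  enum_val (cast_ord (esym card_upper) k).

Definition sort_pair (i j : 'I_n) : 'I_n * 'I_n :=
  if (i <= j)%N then (i, j) else (j, i).

Lemma sort_pair_upper i j : sort_pair i j \in upper.
Proof. by rewrite /sort_pair; case: (leqP i j) => h; rewrite inE //= ltnW. Qed.

Definition uidx_inv (i j : 'I_n) : 'I_(symdim n) :=
  cast_ord card_upper (enum_rank_in (sort_pair_upper i j) (sort_pair i j)).

Lemma uidxK i j : uidx (uidx_inv i j) = sort_pair i j.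
Proof. by rewrite /uidx /uidx_inv cast_ordK enum_rankK_in ?sort_pair_upper. Qed.

Lemma uidx_invK k : uidx_inv (uidx k).1 (uidx k).2 = k.
Proof.
apply: (@cast_ord_inj _ _ (esym card_upper)); apply: enum_val_inj.
rewrite -[LHS]/(uidx _) uidxK -/(uidx k) /sort_pair.
have := enum_valP (cast_ord (esym card_upper) k).
by rewrite inE -/(uidx k) => ->; case: (uidx k).
Qed.

Lemma uidx_invC i j : uidx_inv i j = uidx_inv j i.
Proof.
apply: (@cast_ord_inj _ _ (esym card_upper)); apply: enum_val_inj.
rewrite -[LHS]/(uidx _) -[RHS]/(uidx _) !uidxK /sort_pair.
by case: ltngtP => // /val_inj ->.
Qed.

End UpperIndices.

Section SymType.
Context (R : realType) (n : nat).

Definition symm_pred : {pred 'M[R]_n} := [pred A | A^T == A].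

Lemma symm_predP A : reflect (A^T = A) (A \in symm_pred).
Proof. exact: eqP. Qed.

Lemma symm_submod_closed : submod_closed symm_pred.
Proof.
split=> [|a A B /symm_predP hA /symm_predP hB]; apply/symm_predP.
  exact: trmx0.
by rewrite linearP /= hA hB.
Qed.

HB.instance Definition _ :=
  GRing.isSubmodClosed.Build R 'M[R]_n symm_pred symm_submod_closed.

Record Sym := MkSym { symmx :> 'M[R]_n; _ : symmx \in symm_pred }.

HB.instance Definition _ := [isSub for symmx].
HB.instance Definition _ := [Choice of Sym by <:].
HB.instance Definition _ := [SubChoice_isSubLmodule of Sym by <:].

Lemma symmxT (A : Sym) : A^T = A :> 'M[R]_n.
Proof. exact/symm_predP/valP. Qed.

Definition symcoord (A : Sym) : 'rV[R]_(symdim n) :=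
  \row_k A (uidx k).1 (uidx k).2.

Lemma symcoord_inv_subproof (x : 'rV[R]_(symdim n)) :
  \matrix_(i, j) x 0 (uidx_inv i j) \in symm_pred.
Proof. by apply/symm_predP/matrixP => i j; rewrite !mxE uidx_invC. Qed.

Definition symcoord_inv (x : 'rV[R]_(symdim n)) : Sym :=
  MkSym (symcoord_inv_subproof x).

Lemma symcoordK : cancel symcoord symcoord_inv.
Proof.
move=> A; apply/val_inj/matrixP => i j /=; rewrite !mxE uidxK /sort_pair.
by case: ifP => //= _; rewrite -[in LHS](symmxT A) mxE.
Qed.

Lemma symcoord_invK : cancel symcoord_inv symcoord.
Proof. by move=> x; apply/rowP => k; rewrite !mxE uidx_invK. Qed.

Lemma symcoord_vector_axiom : Vector.axiom (symdim n) Sym.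
Proof.
exists symcoord; last by exists symcoord_inv; [exact: symcoordK|exact: symcoord_invK].
by move=> a A B; apply/rowP => k; rewrite !mxE.
Qed.

HB.instance Definition _ := Lmodule_hasFinDim.Build R Sym symcoord_vector_axiom.

Lemma dim_Sym : \dim {: Sym} = symdim n.
Proof. exact: dimvf. Qed.

Let norm (A : Sym) : R := `|A : 'M[R]_n|.

Let ler_norm_Sym A B : norm (A + B) <= norm A + norm B.
Proof. exact: ler_normD. Qed.

Let norm_SymZ a A : norm (a *: A) = `|a| * norm A.
Proof. exact: normrZ. Qed.

Let norm_Sym0 A : norm A = 0 -> A = 0.
Proof. by move/normr0_eq0 => h; apply/val_inj. Qed.

HB.instance Definition _ :=
  Lmodule_isNormed.Build R Sym ler_norm_Sym norm_SymZ norm_Sym0.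

Definition SPD : set Sym :=
  [set P | forall v : 'rV[R]_n, v != 0 -> 0 < (v *m P *m v^T) 0 0].

Lemma sandwich_subproof (S X : Sym) : S *m X *m S \in symm_pred.
Proof. by apply/symm_predP; rewrite !trmx_mul !symmxT mulmxA. Qed.

Definition sandwich (S X : Sym) : Sym := MkSym (sandwich_subproof S X).

Definition mexp (X : 'M[R]_n) : 'M[R]_n :=
  limn (series (fun k => k`!%:R^-1 *: X ^+ k)).

(* On a positive definite matrix both [get]s below pick the unique solution. *)
Definition mlog (A : 'M[R]_n) : Sym := get [set X : Sym | mexp X = A].

Definition msqrt (P : Sym) : Sym := get [set S | SPD S /\ S *m S = P].

(* log (P^{-1/2} Q P^{-1/2}) *)
Definition whitened_log (P Q : Sym) : Sym :=
  mlog (invmx (msqrt P) *m Q *m invmx (msqrt P)).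

Definition riem_dist (P Q : Sym) : R :=
  Num.sqrt (\tr (whitened_log P Q *m whitened_log P Q)).

Definition riem_log (P Q : Sym) : Sym :=
  sandwich (msqrt P) (whitened_log P Q).

End SymType.

Section LebesgueMeasure.
Context (R : realType).

(* Lebesgue measure on R^m as the m-fold product of the one-dimensional one;
   the recursion step is the library's product measure along R^(m+1) = R * R^m. *)
Fixpoint lebesgue (m : nat) : set (m.-tuple R) -> \bar R :=
  match m with
  | 0 => fun A => \d_([tuple] : 0.-tuple R) A
  | k.+1 => fun A =>
      (\int[lebesgue_measure]_x lebesgue [set t : k.-tuple R | A [tuple of x :: t]])%E
  end.

Definition lebesgue_null (n : nat) (A : set (Sym R n)) : Prop :=
  (@lebesgue (symdim n)).-negligible
    [set t | exists2 P, A P & t = [tuple symcoord P 0 k | k < symdim n]].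

End LebesgueMeasure.

Section DistanceMap.
Context (R : realType) (n l : nat) (Rs : 'I_l -> Sym R n).

(* F is only meaningful on SPD(n), which is open in Sym(n), so that its
   differential at a point of SPD(n) does not see the values taken outside. *)
Definition dist_map (P : Sym R n) : 'rV[R]_l :=
  \row_i riem_dist (Rs i) P ^+ 2.

Definition log_rank (P : Sym R n) : nat :=
  \dim <<[tuple riem_log P (Rs i) | i < l]>>%VS.

Definition log_singular : set (Sym R n) :=
  [set P | SPD P /\ (log_rank P < symdim n)%N].

Definition log_regular : set (Sym R n) := @SPD R n `\` log_singular.

End DistanceMap.

Definition locally_invertible_at (R : realType) (n l : nat)
    (F : Sym R n -> 'rV[R]_l) (P : Sym R n) : Prop :=
  differentiable F P /\ \dim (limg (linfun ('d F P))) = symdim n.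

(* Main.v *)
(* On [Sym(n)] write [log_P R = - P S^-1 log(S^-1 P S^-1) S] with [S = R^(1/2)], so
   that [P] enters only through the logarithm of a matrix depending linearly on it.

   Differentiability of [P |-> tr log(S^-1 P S^-1)^2] at a given [P], with the expected
   differential, and continuity of the matrix logarithm follow from scalar inequalities
   for [ln], transported to traces by diagonalizing both matrices orthogonally.  Since
   [tr(P^-1 V P^-1 V) > 0] for [V <> 0], the differential of [F] is injective as soon as
   the [log_P R_i] span [Sym(n)].

   The Gram determinant [g(P)] of the [log_P R_i] vanishes exactly on the singular set.
   Along a segment of the convex set [SPD(n)] it is analytic, because
   [log A = ln c - sum_k (1 - A/c)^k / k] locally; hence it has finitely many zeros on a
   segment issued from a point where it does not vanish.  As [g(Q) <> 0], an induction on
   the dimension along the iterated integral shows that its zero set is null. *)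
Require Import Defs.
From HB Require Import structures.
From mathcomp Require Import all_boot all_order all_algebra.
From mathcomp Require Import all_classical all_reals all_analysis.
From mathcomp Require Import measurable_realfun.
From mathcomp Require complex finmap.
From mathcomp Require Import ring lra.
Import Order.TTheory GRing.Theory Num.Theory.
Import numFieldNormedType.Exports.
Set Implicit Arguments.
Unset Strict Implicit.
Unset Printing Implicit Defensive.
Local Open Scope classical_set_scope.
Local Open Scope ring_scope.

(** * Orthogonal diagonalization *)

(** Three obstacles shape the argument. [riem_log P Q] is defined through [msqrt P], whose
    dependence on [P] would need its own study; comparing [M M^T] with [M^T M] for
    [M = P^(1/2) R^(-1/2)] leaves only square roots of the fixed matrices. Analyticity is encoded as
    uniform approximation by polynomials with a bounded weighted coefficient norm. Without that
    bound every continuous function would qualify, by Weierstrass; with it, each zero near the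
    centre costs a factor [1/2], so infinitely many zeros force local vanishing. The measure is an
    iterated integral applied to arbitrary sets, so the inner integral is not known to be measurable
    in the outer variable. The bad slices are therefore shown to be countable rather than merely
    null, since a function vanishing off a countable set is automatically measurable. Negligibility
    also asks for a measurable cover, whence the continuity of the Gram determinant. *)

Section DotProduct.
Context (R : realType).

Lemma dotmxE n (u v : 'rV[R]_n) : (u *m v^T) 0 0 = \sum_i u 0 i * v 0 i.
Proof. by rewrite mxE; apply: eq_bigr => i _; rewrite mxE. Qed.

Lemma dotmx_ge0 n (u : 'rV[R]_n) : 0 <= (u *m u^T) 0 0.
Proof. by rewrite dotmxE sumr_ge0 // => i _; rewrite -expr2 sqr_ge0. Qed.

Lemma dotmx_eq0 n (u : 'rV[R]_n) : ((u *m u^T) 0 0 == 0) = (u == 0).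
Proof.
apply/eqP/eqP => [|->]; last by rewrite mul0mx mxE.
rewrite dotmxE => /psumr_eq0P h; apply/rowP => i; rewrite mxE; apply/eqP.
by rewrite -sqrf_eq0 expr2 h // => j _; rewrite -expr2 sqr_ge0.
Qed.

Lemma dotmx_gt0 n (u : 'rV[R]_n) : (0 < (u *m u^T) 0 0) = (u != 0).
Proof. by rewrite lt_def dotmx_eq0 dotmx_ge0 andbT. Qed.

End DotProduct.

Section RealEigenvector.
Import complex.
Context (R : realType).

(* An eigenvector of [A] over [R[i]] has real and imaginary parts [x], [y] with
   [x A = a x - b y] and [y A = b x + a y]; symmetry of [A] forces [b = 0]. *)
Lemma sym_eigenvector n (A : 'M[R]_n) : (0 < n)%N -> A^T = A ->
  exists (a : R) (v : 'rV[R]_n), v != 0 /\ v *m A = a *: v.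
Proof.
move=> n0 symA.
pose Ac := map_mx (@real_complex_def R (Phant R)) A.
have [z /eigenvalueP[v vA v0]] := eigenvalue_closed Ac n0.
pose x := map_mx (@Re R) v; pose y := map_mx (@Im R) v.
have Re_sum I (r : seq I) (F : I -> R[i]) :
  Re (\sum_(i <- r) F i) = \sum_(i <- r) Re (F i).
  exact: (raddf_sum (@Re R : Rcomplex R -> R)).
have Im_sum I (r : seq I) (F : I -> R[i]) :
  Im (\sum_(i <- r) F i) = \sum_(i <- r) Im (F i).
  exact: (raddf_sum (@Im R : Rcomplex R -> R)).
have xA : x *m A = Re z *: x - Im z *: y.
  apply/rowP => j; rewrite !mxE.
  have /(congr1 (@Re R)) := congr1 (fun u : 'rV_n => u 0 j) vA; rewrite !mxE Re_sum.
  under eq_bigr do rewrite !mxE.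
  case: z {vA} => a b; case: (v 0 j) => c d /= <-.
  by apply: eq_bigr => k _; rewrite !mxE; case: (v 0 k) => e f /=; rewrite mulr0 subr0.
have yA : y *m A = Im z *: x + Re z *: y.
  apply/rowP => j; rewrite !mxE.
  have /(congr1 (@Im R)) := congr1 (fun u : 'rV_n => u 0 j) vA; rewrite !mxE Im_sum.
  under eq_bigr do rewrite !mxE.
  case: z {vA xA} => a b; case: (v 0 j) => c d /=; rewrite addrC => <-.
  by apply: eq_bigr => k _; rewrite !mxE; case: (v 0 k) => e f /=; rewrite mulr0 add0r.
have b0 : Im z * ((x *m x^T) 0 0 + (y *m y^T) 0 0) = 0.
  have : ((x *m A) *m y^T) 0 0 = (x *m (y *m A)^T) 0 0 by rewrite trmx_mul symA mulmxA.
  rewrite xA yA mulmxBl [(_ + _)^T]raddfD /= mulmxDr ![(_ *: _)^T]linearZ /=.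
  rewrite -!scalemxAl -!scalemxAr => /=; rewrite !mxE => h.
  by rewrite mulrDr; lra.
have v00 : x != 0 \/ y != 0.
  have [x0|] := eqVneq x 0; last by left.
  right; apply/eqP => y0; case/eqP: v0; apply/rowP => i; rewrite mxE.
  have := congr1 (fun u : 'rV_n => u 0 i) x0.
  have := congr1 (fun u : 'rV_n => u 0 i) y0; rewrite !mxE.
  by case: (v 0 i) => c d /= -> ->.
have bz : Im z = 0.
  move/eqP: b0; rewrite mulf_eq0 => /orP[/eqP//|].
  rewrite paddr_eq0 ?dotmx_ge0 // !dotmx_eq0 => /andP[/eqP xx /eqP yy].
  by rewrite xx yy eqxx in v00; case: v00.
rewrite bz !scale0r subr0 in xA; rewrite bz !scale0r add0r in yA.
by case: v00 => ?; exists (Re z); [exists x|exists y].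
Qed.

End RealEigenvector.

Section Spectral.
Context (R : realType).

(* [H] is the Householder reflection exchanging [v] and the first basis vector. *)
Lemma unit_row_orthogonal n (v : 'rV[R]_(1 + n)) : v *m v^T = 1%:M ->
  exists H : 'M[R]_(1 + n), H *m H^T = 1%:M /\ delta_mx 0 0 *m H = v.
Proof.
move=> vv; pose e : 'rV[R]_(1 + n) := delta_mx 0 0; pose w := v - e.
have ee : e *m e^T = 1%:M.
  apply/matrixP => i j; rewrite !ord1 /e trmx_delta mul_delta_mx !mxE.
  by rewrite !eqxx.
have [w0|w0] := eqVneq w 0.
  exists 1%:M; rewrite trmx1 !mulmx1; split => //.
  by apply/esym/eqP; rewrite -subr_eq0; apply/eqP.
have [c wc] : exists c, w *m w^T = c%:M by exists ((w *m w^T) 0 0); exact: mx11_scalar.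
have c0 : c != 0 by move: w0; rewrite -dotmx_eq0 wc mxE eqxx.
have [d ed] : exists d, e *m v^T = d%:M by exists ((e *m v^T) 0 0); exact: mx11_scalar.
have ve : v *m e^T = d%:M by rewrite -[LHS]trmxK trmx_mul trmxK ed tr_scalar_mx.
have cd : c = 2 - 2 * d.
  have : w *m w^T = c%:M by [].
  rewrite /w linearB /= mulmxBl !mulmxBr vv ve ed ee.
  by move/matrixP/(_ 0 0); rewrite !mxE eqxx /=; lra.
have ew : w = v - e by [].
move: w ew {w0} wc => w ew wc.
pose H := 1%:M - (2 / c) *: (w^T *m w).
have HT : H^T = H by rewrite /H linearB /= linearZ /= trmx_mul trmxK trmx1.
exists H; split; last first.
  rewrite /H mulmxBr mulmx1 -scalemxAr mulmxA -/e.
  have -> : e *m w^T = (d - 1)%:M.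
    by rewrite ew linearB /= mulmxBr ed ee; apply/matrixP => i j; rewrite !ord1 !mxE.
  rewrite mul_scalar_mx scalerA.
  have -> : 2 / c * (d - 1) = -1.
    have -> : d - 1 = - c / 2.
      by rewrite cd; field.
    by field.
  by rewrite scaleN1r opprK ew addrC subrK.
rewrite HT /H mulmxBl mul1mx mulmxBr mulmx1 -scalemxAl -scalemxAr !scalerA.
rewrite mulmxA -(mulmxA w^T w w^T) wc -mulmxA mul_scalar_mx -scalemxAr scalerA.
rewrite -scalerBl -[RHS]subr0 -addrA -opprD -scalerDl.
have -> : 2 / c + (2 / c - 2 / c * (2 / c) * c) = 0 by field.
by rewrite scale0r.
Qed.

(** Deflation: [H] sends the first basis vector to a unit eigenvector [u], so the first row of
    [H A H^T] is [a] times that basis vector. By symmetry so is the first column, and the induction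
    hypothesis diagonalizes the remaining block. *)
Lemma sym_spectral n (A : 'M[R]_n) : A^T = A ->
  exists (U : 'M[R]_n) (a : 'rV[R]_n), U *m U^T = 1%:M /\ A = U^T *m diag_mx a *m U.
Proof.
elim: n A => [|n IH] A symA.
  by exists 0, 0; split; apply/matrixP => -[].
have [a [v [v0 vA]]] := sym_eigenvector (ltn0Sn n) symA.
pose u := (Num.sqrt ((v *m v^T) 0 0))^-1 *: v.
have uu : u *m u^T = 1%:M.
  rewrite /u linearZ /= -scalemxAl -scalemxAr scalerA -expr2 exprVn.
  rewrite sqr_sqrtr ?dotmx_ge0 //; apply/matrixP => i j; rewrite !ord1 [LHS]mxE [RHS]mxE.
  by rewrite eqxx mulVf // dotmx_eq0.
have uA : u *m A = a *: u by rewrite /u -scalemxAl vA !scalerA mulrC.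
have [H [HH eH]] := unit_row_orthogonal uu.
have HH' : H^T *m H = 1%:M by exact: mulmx1C.
pose B := H *m A *m H^T.
have symB : B^T = B by rewrite /B !trmx_mul trmxK symA mulmxA.
have eB : delta_mx 0 0 *m B = a *: (delta_mx 0 0 : 'rV_(1 + n)).
  by rewrite /B !mulmxA eH uA -eH -!scalemxAl -mulmxA HH mulmx1.
have row0B j : B 0 j = a *+ nat_of_bool (j == 0).
  by have /matrixP/(_ 0 j) := eB; rewrite -rowE !mxE => ->; rewrite eqxx /= mulr_natr.
have ulB : ulsubmx (B : 'M[R]_(1 + n)) = a%:M.
  apply/matrixP => i j; rewrite !ord1 /ulsubmx 2!mxE [RHS]mxE.
  by rewrite (_ : lshift n 0 = 0) ?row0B; last exact: val_inj.
have urB : ursubmx (B : 'M[R]_(1 + n)) = 0.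
  apply/matrixP => i j; rewrite !ord1 /ursubmx 2!mxE [RHS]mxE.
  by rewrite (_ : lshift n 0 = 0) ?row0B; last exact: val_inj.
have dlB : dlsubmx (B : 'M[R]_(1 + n)) = 0.
  by rewrite -[B]symB -trmx_ursub urB trmx0.
have [|U [d [UU eqU]]] := IH (drsubmx (B : 'M[R]_(1 + n))).
  by rewrite trmx_drsub symB.
have UU' : U^T *m U = 1%:M by exact: mulmx1C.
pose V : 'M[R]_(1 + n) := block_mx 1%:M 0 0 U.
have VT : V^T = block_mx 1%:M 0 0 U^T by rewrite /V tr_block_mx !trmx0 trmx1.
have VV : V *m V^T = 1%:M.
  rewrite VT /V mulmx_block !mulmx0 !mul0mx !mulmx1 ?addr0 ?add0r UU.
  by rewrite -scalar_mx_block.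
have eqB : V^T *m diag_mx (row_mx a%:M d) *m V = B.
  rewrite -[B](@submxK _ 1 n 1 n) ulB urB dlB eqU diag_mx_row VT /V.
  rewrite !mulmx_block !(mulmx0, mul0mx, mulmx1, mul1mx, addr0, add0r).
  by congr block_mx; apply/matrixP => i j; rewrite !ord1 !mxE.
exists (V *m H), (row_mx a%:M d); split.
  by rewrite trmx_mul mulmxA -(mulmxA V) HH mulmx1.
rewrite trmx_mul !mulmxA -!(mulmxA H^T) -(mulmxA V^T) in eqB *.
by rewrite mulmxA eqB /B !mulmxA HH' mul1mx -mulmxA HH' mulmx1.
Qed.

End Spectral.

(** * Matrix exponential, logarithm and square root *)

Section MatrixNorm.
Context (R : realType).

Lemma mx_norm_le m n (A : 'M[R]_(m, n)) (e : R) : 0 <= e ->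
  (forall i j, `|A i j| <= e) -> `|A| <= e.
Proof.
move=> e0 Ae; rewrite /Num.norm /= mx_normrE.
by apply: bigmax_le => // -[i j] _; exact: Ae.
Qed.

Lemma mx_norm_lt m n (A : 'M[R]_(m, n)) (e : R) : 0 < e ->
  (forall i j, `|A i j| < e) -> `|A| < e.
Proof.
move=> e0 Ae; rewrite /Num.norm /= mx_normrE.
by apply: bigmax_lt => // -[i j] _; exact: Ae.
Qed.

Lemma le_mx_norm m n (A : 'M[R]_(m, n)) i j : `|A i j| <= `|A|.
Proof.
rewrite [leRHS]/Num.norm /= mx_normrE.
by apply: (le_bigmax _ (fun ij : 'I_m * 'I_n => `|A ij.1 ij.2|) (i, j)).
Qed.

Lemma cvg_mx m n (f : nat -> 'M[R]_(m, n)) (l : 'M[R]_(m, n)) :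
  (forall i j, (fun k => f k i j) @ \oo --> l i j) -> f @ \oo --> l.
Proof.
move=> fl; apply/cvgrPdist_lt => e e0.
have : \forall k \near \oo, forall i j, `|l i j - f k i j| < e.
  by apply: filter_forall => i; apply: filter_forall => j; move/cvgrPdist_lt: (fl i j); exact.
apply: filterS => k fk; apply: mx_norm_lt => // i j.
by rewrite !mxE; exact: fk.
Qed.

End MatrixNorm.

Section OrthogonalDiagonal.
Context (R : realType) (n : nat).
Implicit Types (U V A : 'M[R]_n) (x y : 'rV[R]_n).

(** For orthogonal [U] the rows of [U] are eigenvectors and [x] lists the eigenvalues; functional
    calculus is then [map_mx] on [x]. *)
Definition odiag U x : 'M[R]_n := U^T *m diag_mx x *m U.

Lemma odiagE U x i j : odiag U x i j = \sum_k x 0 k * (U k i * U k j).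
Proof.
rewrite /odiag mxE; apply: eq_bigr => k _; rewrite mul_mx_diag !mxE.
by rewrite mulrAC mulrC.
Qed.

Lemma odiag_symm U x : odiag U x \in @symm_pred R n.
Proof.
by apply/symm_predP; rewrite /odiag !trmx_mul trmxK tr_diag_mx mulmxA.
Qed.

Definition osym U x : Sym R n := MkSym (odiag_symm U x).

Lemma odiagM U x y : U *m U^T = 1%:M ->
  odiag U x *m odiag U y = odiag U (\row_i (x 0 i * y 0 i)).
Proof.
move=> oU; rewrite /odiag !mulmxA -(mulmxA _ U) oU mulmx1 -(mulmxA U^T) mulmx_diag.
by congr (_ *m diag_mx _ *m _); apply/rowP => i; rewrite !mxE.
Qed.

Lemma odiag_const U (c : R) : U *m U^T = 1%:M -> odiag U (const_mx c) = c%:M.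
Proof.
by move=> oU; rewrite /odiag diag_const_mx mul_mx_scalar -scalemxAl (mulmx1C oU) scalemx1.
Qed.

Lemma odiagX U x k : U *m U^T = 1%:M ->
  odiag U x ^+ k = odiag U (map_mx (fun t => t ^+ k) x).
Proof.
move=> oU; elim: k => [|k IH].
  rewrite expr0 (_ : map_mx _ _ = const_mx 1) ?odiag_const //.
  by apply/rowP => i; rewrite !mxE.
rewrite exprS IH -[LHS]/(_ *m _) odiagM //; congr odiag.
by apply/rowP => i; rewrite !mxE exprS.
Qed.

Lemma mexp_odiag U x : U *m U^T = 1%:M ->
  mexp (odiag U x) = odiag U (map_mx expR x).
Proof.
move=> oU; apply: cvg_lim => //; apply: cvg_mx => i j.
have -> : (fun k => series (fun k0 => k0`!%:R^-1 *: odiag U x ^+ k0) k i j) =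
    (fun k => \sum_l series (exp_coeff (x 0 l)) k * (U l i * U l j)).
  apply/funext => k; rewrite /series /= summxE.
  under [RHS]eq_bigr do rewrite mulr_suml.
  rewrite exchange_big /=; apply: eq_bigr => p _.
  rewrite odiagX // mxE odiagE mulr_sumr; apply: eq_bigr => l _.
  by rewrite !mxE /exp_coeff /= mulrCA mulrA.
rewrite odiagE; apply: cvg_big => [|l _]; first exact: add_continuous.
by apply: cvgMr_tmp; rewrite mxE; exact: is_cvg_series_exp_coeff.
Qed.

(** With [W = U V^T] the hypothesis reads [f(x_i) W_ij = W_ij f(y_j)], so [x_i = y_j] wherever
    [W_ij] is nonzero, and the same identity holds with [f] removed. This gives uniqueness of the
    logarithm without eigenspaces. *)
Lemma odiag_inj (f : R -> R) U V x y : injective f ->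
  U *m U^T = 1%:M -> V *m V^T = 1%:M ->
  odiag U (map_mx f x) = odiag V (map_mx f y) -> odiag U x = odiag V y.
Proof.
move=> finj oU oV e; have oV' := mulmx1C oV.
have : diag_mx (map_mx f x) *m (U *m V^T) = U *m V^T *m diag_mx (map_mx f y).
  have := congr1 (fun M => U *m M *m V^T) e; rewrite /odiag !mulmxA oU mul1mx.
  by rewrite -(mulmxA _ V) oV mulmx1.
move/matrixP => h.
suff hx : diag_mx x *m (U *m V^T) = U *m V^T *m diag_mx y.
  have := congr1 (fun M => U^T *m M *m V) hx.
  rewrite /odiag !mulmxA (mulmx1C oU) mul1mx => <-.
  by rewrite -(mulmxA _ V^T) oV' mulmx1.
apply/matrixP => i j; have := h i j; rewrite !mul_diag_mx !mul_mx_diag.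
rewrite !mxE; have [->|w0] := eqVneq (\sum_k U i k * V^T k j) 0.
  by rewrite !mulr0 !mul0r.
by rewrite mulrC => /(mulfI w0)/finj ->; rewrite mulrC.
Qed.

Lemma Sym_spectral (P : Sym R n) :
  exists U x, U *m U^T = 1%:M /\ symmx P = odiag U x.
Proof. exact/sym_spectral/symmxT. Qed.

Lemma mlog_odiag U x : U *m U^T = 1%:M -> (forall i, 0 < x 0 i) ->
  mlog (odiag U x) = osym U (map_mx (@ln R) x).
Proof.
move=> oU x0.
have xE : x = map_mx expR (map_mx (@ln R) x).
  by apply/rowP => i; rewrite !mxE lnK // posrE.
apply: get_unique => [/=|Y /= eY].
  by rewrite [RHS](congr1 (odiag U) xE) mexp_odiag.
apply: val_inj => /=; have [V [y [oV eV]]] := Sym_spectral Y.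
rewrite eV; apply: (@odiag_inj expR) => //; first exact: expR_inj.
by rewrite -mexp_odiag // -eV eY -xE.
Qed.

Lemma quad_odiag U x (v : 'rV[R]_n) :
  (v *m odiag U x *m v^T) 0 0 = \sum_i x 0 i * (v *m U^T) 0 i ^+ 2.
Proof.
rewrite /odiag !mulmxA -mulmxA -[U *m v^T]trmxK trmx_mul trmxK mul_mx_diag.
by rewrite dotmxE; apply: eq_bigr => i _; rewrite [in LHS]mxE expr2 mulrAC mulrC.
Qed.

Lemma row_odiag U x i : U *m U^T = 1%:M ->
  (row i U *m odiag U x *m (row i U)^T) 0 0 = x 0 i.
Proof.
move=> oU; rewrite quad_odiag.
have rU j : (row i U *m U^T) 0 j = (i == j)%:R by rewrite -row_mul oU !mxE.
under eq_bigr do rewrite rU.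
rewrite (bigD1 i) //= eqxx expr1n mulr1 big1 ?addr0 // => j /negbTE ji.
by rewrite eq_sym ji expr0n mulr0.
Qed.

Lemma SPD_odiag U x (P : Sym R n) : U *m U^T = 1%:M -> symmx P = odiag U x ->
  SPD P <-> (forall i, 0 < x 0 i).
Proof.
move=> oU eP; split => [hP i|x0 v v0].
  have := hP (row i U); rewrite eP row_odiag //; apply; apply/eqP => r0.
  (* With all eigenvalues equal to 1 this gives row [i] of [U] norm 1, so it cannot vanish. *)
  have /eqP := row_odiag (const_mx 1) i oU.
  by rewrite r0 !mul0mx !mxE eq_sym oner_eq0.
rewrite eP quad_odiag lt_def sumr_ge0 ?andbT => [|i _]; last first.
  by rewrite mulr_ge0 ?sqr_ge0 // ltW.
apply: contra v0 => /eqP /psumr_eq0P h.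
suff vU : v *m U^T = 0.
  by rewrite -[v]mulmx1 -(mulmx1C oU) mulmxA vU mul0mx.
apply/rowP => i; rewrite [RHS]mxE; apply/eqP; rewrite -sqrf_eq0.
have /eqP := h (fun i _ => mulr_ge0 (ltW (x0 i)) (sqr_ge0 _)) i isT.
by rewrite mulf_eq0 (gt_eqF (x0 i)).
Qed.

Lemma SPD_osym U x : U *m U^T = 1%:M -> (forall i, 0 < x 0 i) -> SPD (osym U x).
Proof. by move=> oU x0; apply/(@SPD_odiag U x (osym U x)). Qed.

Lemma msqrtP (P : Sym R n) : SPD P -> SPD (msqrt P) /\ msqrt P *m msqrt P = P.
Proof.
move=> hP; have [U [x [oU eP]]] := Sym_spectral P.
have x0 := (SPD_odiag oU eP).1 hP.
apply: (@getPex _ [set S | SPD S /\ S *m S = P]).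
exists (osym U (map_mx Num.sqrt x)); split => /=.
  by apply: SPD_osym => // i; rewrite mxE sqrtr_gt0.
rewrite eP odiagM //; congr odiag; apply/rowP => i.
by rewrite !mxE -expr2 sqr_sqrtr // ltW.
Qed.

Lemma odiag_mulV U x : U *m U^T = 1%:M -> (forall i, 0 < x 0 i) ->
  odiag U x *m odiag U (map_mx GRing.inv x) = 1%:M.
Proof.
move=> oU x0; rewrite odiagM // -(odiag_const 1 oU); congr odiag.
by apply/rowP => i; rewrite !mxE mulfV // gt_eqF.
Qed.

Lemma odiag_inv U x : U *m U^T = 1%:M -> (forall i, 0 < x 0 i) ->
  invmx (odiag U x) = odiag U (map_mx GRing.inv x).
Proof.
move=> oU x0; have h := odiag_mulV oU x0; have [uA _] := mulmx1_unit h.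
by rewrite -[LHS]mulmx1 -h mulmxA mulVmx // mul1mx.
Qed.

Lemma SPD_unit (P : Sym R n) : SPD P -> symmx P \in unitmx.
Proof.
move=> hP; have [U [x [oU eP]]] := Sym_spectral P.
by rewrite eP; have [] := mulmx1_unit (odiag_mulV oU ((SPD_odiag oU eP).1 hP)).
Qed.

End OrthogonalDiagonal.

(** * The Riemannian logarithm and trace inequalities *)

Section RiemannianLog.
Context (R : realType) (n : nat).
Implicit Types (P Q S : Sym R n).

Lemma gram_spectral (M : 'M[R]_n) : M \in unitmx ->
  exists (U : 'M[R]_n) (a : 'rV[R]_n), [/\ U *m U^T = 1%:M, forall i, 0 < a 0 i & M^T *m M = odiag U a].
Proof.
move=> uM; have symMM : M^T *m M \in @symm_pred R n.
  by apply/symm_predP; rewrite trmx_mul trmxK.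
have [U [a [oU ea]]] := Sym_spectral (MkSym symMM).
exists U, a; split => //; apply/(SPD_odiag oU ea) => v v0 /=.
rewrite !mulmxA -mulmxA -[M *m v^T]trmxK trmx_mul trmxK dotmx_gt0.
apply: contra v0 => /eqP h.
by rewrite -[v]mulmx1 -trmx1 -(mulVmx uM) trmx_mul mulmxA h mul0mx.
Qed.

(* With [M^T M = U^T a U], the matrix [V = a^{-1/2} U M^T] is orthogonal and
   [M M^T = V^T a V]. *)
Lemma mlog_gram (M : 'M[R]_n) : M \in unitmx ->
  mlog (invmx (M *m M^T)) *m M = - (M *m mlog (M^T *m M)).
Proof.
move=> uM; have [U [a [oU a0 ea]]] := gram_spectral uM.
pose r := map_mx (fun t => (Num.sqrt t)^-1) a.
pose V := diag_mx r *m U *m M^T.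
have VT : V^T = M *m U^T *m diag_mx r by rewrite /V !trmx_mul trmxK tr_diag_mx mulmxA.
have rar (f : R -> R) i : r 0 i * f (a 0 i) * r 0 i = f (a 0 i) / a 0 i.
  by rewrite mulrAC !mxE mulrC -expr2 exprVn sqr_sqrtr // ltW.
have oV : V *m V^T = 1%:M.
  rewrite VT /V !mulmxA -(mulmxA _ M^T) ea /odiag !mulmxA.
  rewrite -(mulmxA _ U U^T) oU mulmx1 -(mulmxA _ U U^T) oU mulmx1 !mulmx_diag.
  rewrite [X in diag_mx X](_ : _ = const_mx 1) ?diag_const_mx //.
  apply/rowP => i; rewrite !mxE.
  by have := rar id i; rewrite !mxE => ->; rewrite mulfV // gt_eqF.
have VE f : odiag V (map_mx f a) = M *m odiag U (map_mx (fun t => f t / t) a) *m M^T.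
  rewrite /odiag VT /V !mulmxA -(mulmxA (M *m U^T)) mulmx_diag.
  rewrite -(mulmxA (M *m U^T)) mulmx_diag; congr (_ *m diag_mx _ *m _ *m _).
  by apply/rowP => i; have := rar f i; rewrite !mxE.
have -> : M *m M^T = odiag V a.
  have -> : a = map_mx id a by apply/rowP => i; rewrite !mxE.
  rewrite VE (_ : map_mx _ _ = const_mx 1) ?odiag_const ?mulmx1 //.
  by apply/rowP => i; rewrite !mxE mulfV // gt_eqF.
have ia i : 0 < map_mx GRing.inv a 0 i by rewrite mxE invr_gt0.
rewrite odiag_inv // mlog_odiag // ea mlog_odiag //= -map_mx_comp VE.
rewrite -(mulmxA _ M^T) ea -(mulmxA M) odiagM // -mulmxN; congr (_ *m _).
rewrite /odiag -mulNmx -mulmxN -raddfN; congr (_ *m diag_mx _ *m _).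
by apply/rowP => i; rewrite !mxE /= lnV ?posrE // divfK // gt_eqF.
Qed.

Lemma isym_subproof S : invmx S \in @symm_pred R n.
Proof. by apply/symm_predP; rewrite trmx_inv symmxT. Qed.

Definition isym S : Sym R n := MkSym (isym_subproof S).

Definition whiten Q P : Sym R n := sandwich (isym (msqrt Q)) P.

Lemma SPD_sandwich S P : symmx S \in unitmx -> SPD P -> SPD (sandwich S P).
Proof.
move=> uS hP v v0 /=; rewrite !mulmxA -mulmxA -[S *m v^T]trmxK trmx_mul trmxK symmxT.
apply: hP; apply: contra v0 => /eqP h.
by rewrite -[v]mulmx1 -(mulmxV uS) mulmxA h mul0mx.
Qed.

Lemma SPD_whiten Q P : SPD Q -> SPD P -> SPD (whiten Q P).
Proof.
move=> hQ; apply: SPD_sandwich; rewrite unitmx_inv SPD_unit //.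
exact: (msqrtP hQ).1.
Qed.

(** Put [K = P^(1/2)], [S = Q^(1/2)] and [M = K S^-1]. Then [K^-1 Q K^-1 = (M M^T)^-1] and
    [S^-1 P S^-1 = M^T M], so [mlog_gram] trades the logarithm of the first for that of the second;
    the outer factors [K] combine into [P] on the left and cancel on the right. *)
Lemma riem_logE P Q : SPD P -> SPD Q ->
  symmx (riem_log P Q) =
    - (P *m invmx (msqrt Q) *m mlog (whiten Q P) *m msqrt Q).
Proof.
move=> hP hQ; have [hK KK] := msqrtP hP; have [hS SS] := msqrtP hQ.
rewrite /riem_log /whitened_log /=.
set K := msqrt P in hK KK *; set S := msqrt Q in hS SS *.
have uK := SPD_unit hK; have uS := SPD_unit hS.
pose M : 'M[R]_n := K *m invmx S.
have uM : M \in unitmx by rewrite unitmx_mul uK unitmx_inv.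
have MT : M^T = invmx S *m K by rewrite /M trmx_mul trmx_inv !symmxT.
have -> : invmx S *m P *m invmx S = M^T *m M by rewrite MT /M -KK !mulmxA.
have -> : invmx K *m Q *m invmx K = invmx (M *m M^T).
  rewrite -[RHS]mul1mx -(mulmxV (_ : M *m M^T \in unitmx)); last first.
    by rewrite unitmx_mul uM unitmx_tr.
  rewrite -SS MT /M.
  have h : invmx K *m (S *m S) *m invmx K *m (K *m invmx S *m (invmx S *m K)) = 1%:M.
    rewrite !mulmxA mulmxKV // mulmxK // mulmxK // mulVmx //.
  rewrite -[LHS]mulmx1 -[in LHS](mulmxV (_ : K *m invmx S *m (invmx S *m K) \in unitmx)).
    by rewrite mulmxA h mul1mx mulmxV ?mul1mx // !unitmx_mul !unitmx_inv uK uS.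
  by rewrite !unitmx_mul !unitmx_inv uK uS.
have h := mlog_gram uM.
have -> : (mlog (invmx (M *m M^T)) : 'M[R]_n) = - (M *m mlog (M^T *m M) *m invmx M).
  by rewrite -mulNmx -h mulmxK.
rewrite mulmxN mulNmx; congr (- _).
have -> : invmx M = S *m invmx K.
  have e : M *m (S *m invmx K) = 1%:M by rewrite /M mulmxA mulmxKV // mulmxV.
  by rewrite -[RHS]mul1mx -(mulVmx uM) -mulmxA e mulmx1.
by rewrite /M !mulmxA mulmxKV // KK.
Qed.

(** This is the squared Frobenius norm; the next lemmas compare it with the largest entry in
    absolute value, which is the norm on [Sym]. *)
Lemma tr_sqr (X : 'M[R]_n) : X^T = X -> \tr (X *m X) = \sum_i \sum_j X i j ^+ 2.
Proof.
move=> sX; rewrite /mxtrace; apply: eq_bigr => i _; rewrite mxE.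
by apply: eq_bigr => j _; rewrite -[in X in _ * X]sX mxE expr2.
Qed.

Lemma tr_sqr_ge0 (X : 'M[R]_n) : X^T = X -> 0 <= \tr (X *m X).
Proof.
by move=> sX; rewrite tr_sqr // sumr_ge0 // => i _; rewrite sumr_ge0 // => j _; rewrite sqr_ge0.
Qed.

Lemma sqr_le_tr (X : 'M[R]_n) i j : X^T = X -> X i j ^+ 2 <= \tr (X *m X).
Proof.
move=> sX; rewrite tr_sqr // (bigD1 i) //= (bigD1 j) //= -addrA lerDl.
rewrite addr_ge0 ?sumr_ge0 // => k _; rewrite ?sqr_ge0 //.
by rewrite sumr_ge0 // => l _; rewrite sqr_ge0.
Qed.

Lemma tr_sqr_le (X : 'M[R]_n) : X^T = X -> \tr (X *m X) <= (n * n)%:R * `|X| ^+ 2.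
Proof.
move=> sX; rewrite tr_sqr // natrM -mulrA.
apply: (@le_trans _ _ (\sum_(i < n) \sum_(j < n) `|X| ^+ 2)).
  apply: ler_sum => i _; apply: ler_sum => j _.
  by rewrite -(real_normK (num_real (X i j))) lerXn2r ?nnegrE // le_mx_norm.
by rewrite !sumr_const !card_ord !mulr_natl.
Qed.

Lemma riem_dist_sqr Q P :
  riem_dist Q P ^+ 2 = \tr (mlog (whiten Q P) *m mlog (whiten Q P)).
Proof. by rewrite /riem_dist sqr_sqrtr // tr_sqr_ge0 // symmxT. Qed.

End RiemannianLog.

(* If [A = U^T f U] and [B = V^T g V] with [U], [V] orthogonal, every expression
   [tr (p(A) q(B))] is the sum of the [p(f_i) q(g_j)] with the same nonnegative
   weights [(U V^T)_ij ^ 2], so scalar inequalities pass to traces. *)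
Section TraceInequalities.
Context (R : realType) (n : nat).
Variables (U V : 'M[R]_n).
Hypotheses (oU : U *m U^T = 1%:M) (oV : V *m V^T = 1%:M).

Let w i j := (U *m V^T) i j ^+ 2.

Lemma tr_odiag2 f g :
  \tr (odiag U f *m odiag V g) = \sum_i \sum_j f 0 i * g 0 j * w i j.
Proof.
pose W := U *m V^T.
have -> : odiag U f *m odiag V g = U^T *m (diag_mx f *m W *m diag_mx g *m V).
  by rewrite /odiag /W !mulmxA.
rewrite mxtrace_mulC -(mulmxA _ V) -[V *m U^T]trmxK trmx_mul trmxK -/W.
rewrite /mxtrace; apply: eq_bigr => i _; rewrite mxE; apply: eq_bigr => j _.
rewrite mul_mx_diag mxE mul_diag_mx [W^T j i]mxE [X in X * _ * _]mxE /w -/W expr2.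
by ring.
Qed.

Let tr_odiagl h : \tr (odiag U h) = \sum_i \sum_j h 0 i * w i j.
Proof.
rewrite -[odiag U h]mulmx1 -(odiag_const 1 oV) tr_odiag2.
by apply: eq_bigr => i _; apply: eq_bigr => j _; rewrite mxE mulr1.
Qed.

Let tr_odiagr h : \tr (odiag V h) = \sum_i \sum_j h 0 j * w i j.
Proof.
rewrite -[odiag V h]mul1mx -(odiag_const 1 oU) tr_odiag2.
by apply: eq_bigr => i _; apply: eq_bigr => j _; rewrite mxE mul1r.
Qed.

Lemma tr_sqr_diff f g :
  \tr ((odiag U f - odiag V g) *m (odiag U f - odiag V g)) =
  \sum_i \sum_j (f 0 i - g 0 j) ^+ 2 * w i j.
Proof.
rewrite mulmxBl !mulmxBr !raddfB /= [\tr (odiag V g *m odiag U f)]mxtrace_mulC.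
rewrite !odiagM // tr_odiagl tr_odiagr tr_odiag2. rewrite opprK addrA -!sumrB -big_split /=.
apply: eq_bigr => i _; rewrite -!sumrB -big_split /=.
apply: eq_bigr => j _; rewrite !mxE; ring.
Qed.

Variables (a b : 'rV[R]_n) (mu : R).
Hypotheses (mu0 : 0 < mu) (a_mu : forall i, mu <= a 0 i) (b_mu : forall i, mu <= b 0 i).

Let ln_le (x : R) : 0 < x -> ln x <= x - 1.
Proof.
move=> x0; have := @le_ln1Dx R (x - 1).
by rewrite (_ : 1 + (x - 1) = x); [apply; lra|ring].
Qed.

Let lnV_ge (x : R) : 0 < x -> 1 - x^-1 <= ln x.
Proof.
by move=> x0; have := @ln_le x^-1; rewrite invr_gt0 lnV ?posrE // => /(_ x0); lra.
Qed.

Let ln_diff (x y : R) : mu <= x -> mu <= y -> `|ln x - ln y| <= `|x - y| / mu.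
Proof.
wlog xy : x y / y <= x => [hw|] mx my.
  by case: (leP y x) => [|/ltW] xy; [exact: hw|rewrite distrC (distrC x); exact: hw].
have y0 := lt_le_trans mu0 my; have x0 := lt_le_trans mu0 mx.
rewrite ger0_norm ?subr_ge0 ?ler_ln ?posrE // ger0_norm ?subr_ge0 //.
rewrite -ln_div ?posrE //; apply: (le_trans (ln_le _)); first exact: divr_gt0.
have -> : x / y - 1 = (x - y) / y by field; rewrite gt_eqF.
by rewrite ler_wpM2l ?subr_ge0 // lef_pV2 ?posrE.
Qed.

(** For [t = y / x], [ln t] lies between [1 - 1/t] and [t - 1]. The gap between these bounds is
    exactly [(y - x)^2 / (x y)], and [x y >= mu^2]. *)
Let ln_taylor (x y : R) : mu <= x -> mu <= y ->
  `|ln y - ln x - (y - x) / x| <= (y - x) ^+ 2 / mu ^+ 2.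
Proof.
move=> mx my; have y0 := lt_le_trans mu0 my; have x0 := lt_le_trans mu0 mx.
have t0 : 0 < y / x by exact: divr_gt0.
rewrite -ln_div ?posrE //.
have -> : (y - x) / x = y / x - 1 by field; rewrite gt_eqF.
have u := ln_le t0; have l := lnV_ge t0.
rewrite ler0_norm ?subr_le0 // opprB.
apply: (@le_trans _ _ ((y - x) ^+ 2 / (x * y))).
  have -> : (y - x) ^+ 2 / (x * y) = y / x - 1 - (1 - (y / x)^-1).
    by field; rewrite !gt_eqF.
  lra.
rewrite ler_wpM2l ?sqr_ge0 // lef_pV2 ?posrE ?mulr_gt0 ?exprn_gt0 //.
by rewrite expr2 ler_pM // ltW.
Qed.

Let w_ge0 i j : 0 <= w i j. Proof. exact: sqr_ge0. Qed.

Lemma tr_ln_lipschitz :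
  \tr ((odiag U (map_mx (@ln R) a) - odiag V (map_mx (@ln R) b)) *m
       (odiag U (map_mx (@ln R) a) - odiag V (map_mx (@ln R) b))) <=
  mu ^- 2 * \tr ((odiag U a - odiag V b) *m (odiag U a - odiag V b)).
Proof.
rewrite !tr_sqr_diff mulr_sumr; apply: ler_sum => i _.
rewrite mulr_sumr; apply: ler_sum => j _; rewrite [leRHS]mulrA ler_wpM2r //.
rewrite !mxE -(real_normK (num_real (ln _ - _))) -(real_normK (num_real (a 0 i - _))).
rewrite mulrC -exprVn -exprMn lerXn2r ?nnegrE ?divr_ge0 ?mulr_ge0 ?invr_ge0 ?(ltW mu0) //.
exact: ln_diff.
Qed.

Lemma tr_ln_sqr_taylor (K : R) : (forall i, `|ln (a 0 i)| <= K) ->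
  `|\tr (odiag V (map_mx (@ln R) b) *m odiag V (map_mx (@ln R) b))
    - \tr (odiag U (map_mx (@ln R) a) *m odiag U (map_mx (@ln R) a))
    - 2 * \tr (odiag U (map_mx (fun t => ln t / t) a) *m (odiag V b - odiag U a))|
  <= (1 + 2 * K) / mu ^+ 2 *
     \tr ((odiag U a - odiag V b) *m (odiag U a - odiag V b)).
Proof.
move=> aK.
rewrite mulmxBr raddfB /= !odiagM // tr_odiag2 !tr_odiagl tr_odiagr tr_sqr_diff.
rewrite mulrBr !mulr_sumr -!sumrB.
apply: (le_trans (ler_norm_sum _ _ _)); apply: ler_sum => i _.
rewrite !mulr_sumr -!sumrB.
apply: (le_trans (ler_norm_sum _ _ _)); apply: ler_sum => j _.
rewrite !mxE; set x := a 0 i; set y := b 0 j.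
have x0 : 0 < x by exact: lt_le_trans mu0 (a_mu i).
(* Each summand [ln^2 y - ln^2 x - 2 (ln x / x) (y - x)] splits into a squared increment and
   [2 ln x] times the first-order remainder of [ln]; they produce the [1] and the [2 K] of the
   constant. *)
rewrite [X in `|X|](_ : _ =
  ((ln y - ln x) ^+ 2 + 2 * ln x * (ln y - ln x - (y - x) / x)) * w i j); last first.
  by field; rewrite gt_eqF.
rewrite normrM (ger0_norm (w_ge0 i j)) [leRHS]mulrA ler_wpM2r //.
rewrite -(opprB y x) sqrrN.
apply: (le_trans (ler_normD _ _)).
have h1 : `|(ln y - ln x) ^+ 2| <= (y - x) ^+ 2 / mu ^+ 2.
  rewrite normrX -(real_normK (num_real (y - x))) -exprVn -exprMn.
  rewrite lerXn2r ?nnegrE ?divr_ge0 ?mulr_ge0 ?invr_ge0 ?(ltW mu0) //.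
  exact: (ln_diff (b_mu j) (a_mu i)).
have h2 := ln_taylor (a_mu i) (b_mu j).
have h3 : `|2 * ln x * (ln y - ln x - (y - x) / x)| <= 2 * K * ((y - x) ^+ 2 / mu ^+ 2).
  rewrite normrM ler_pM // normrM ger0_norm // ler_pM2l //; exact: aK.
apply: (le_trans (lerD h1 h3)); rewrite le_eqVlt; apply/orP; left; apply/eqP; ring.
Qed.

End TraceInequalities.

(** * Differential of the squared distances *)

Section Bounds.
Context (R : realType).

Lemma mx_norm_mul m n p (A : 'M[R]_(m, n)) (B : 'M[R]_(n, p)) :
  `|A *m B| <= n%:R * `|A| * `|B|.
Proof.
apply: mx_norm_le => [|i j]; first by rewrite !mulr_ge0.
rewrite mxE; apply: (le_trans (ler_norm_sum _ _ _)).
apply: (@le_trans _ _ (\sum_(k < n) `|A| * `|B|)).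
  by apply: ler_sum => k _; rewrite normrM ler_pM // le_mx_norm.
by rewrite sumr_const card_ord -mulrA mulr_natl.
Qed.

Lemma norm_trace n (A : 'M[R]_n) : `|\tr A| <= n%:R * `|A|.
Proof.
apply: (le_trans (ler_norm_sum _ _ _)).
apply: (@le_trans _ _ (\sum_(k < n) `|A|)).
  by apply: ler_sum => k _; rewrite le_mx_norm.
by rewrite sumr_const card_ord mulr_natl.
Qed.

Lemma Sym_normE n (A : Sym R n) : `|A| = `|symmx A|.
Proof. by []. Qed.

Lemma symmxB n (A B : Sym R n) : symmx (A - B) = symmx A - symmx B.
Proof. by []. Qed.

Lemma symmxD n (A B : Sym R n) : symmx (A + B) = symmx A + symmx B.
Proof. by []. Qed.

Lemma symmxZ n c (A : Sym R n) : symmx (c *: A) = c *: symmx A.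
Proof. by []. Qed.

Lemma whiten_linear n (Q : Sym R n) : linear (whiten Q).
Proof.
move=> c A B; apply: val_inj => /=.
by rewrite mulmxDr mulmxDl -scalemxAr -scalemxAl.
Qed.

HB.instance Definition _ n (Q : Sym R n) :=
  GRing.isLinear.Build R (Sym R n) (Sym R n) _ (whiten Q) (whiten_linear Q).

Lemma whiten_bounded n (Q : Sym R n) :
  exists2 c, 0 < c & forall V, `|whiten Q V| <= c * `|V|.
Proof.
set S := isym (msqrt Q).
exists (n%:R * (n%:R * `|symmx S|) * `|symmx S| + 1) => [|V].
  by rewrite ltr_wpDl // !mulr_ge0.
rewrite !Sym_normE /=; apply: (le_trans (mx_norm_mul _ _)).
rewrite mulrDl mul1r; apply: ler_wpDr => //.
rewrite -!mulrA ler_wpM2l // mulrC [leRHS]mulrCA !mulrA.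
have := mx_norm_mul (symmx S) (symmx V).
move/(ler_wpM2r (normr_ge0 (symmx S)))/le_trans; rewrite mulrC; apply.
by rewrite le_eqVlt; apply/orP; left; apply/eqP; rewrite /=; ring.
Qed.

Lemma row_orthonormal n (U : 'M[R]_n) i : U *m U^T = 1%:M ->
  row i U *m (row i U)^T = 1%:M.
Proof.
move=> oU; have := congr1 (fun M : 'M[R]_n => M i i) oU.
rewrite [in RHS]mxE eqxx => h; apply/matrixP => j k; rewrite !ord1 [RHS]mxE eqxx.
by rewrite -[RHS]h !mxE; apply: eq_bigr => l _; rewrite !mxE.
Qed.

Lemma norm_row_orthonormal n (U : 'M[R]_n) i : U *m U^T = 1%:M -> `|row i U| <= 1.
Proof.
move=> /(row_orthonormal i) /(congr1 (fun M : 'M[R]_1 => M 0 0)).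
rewrite dotmxE [in RHS]mxE => h; apply: mx_norm_le => // j k; rewrite ord1.
rewrite -(@ler_pXn2r _ 2) ?nnegrE // expr1n real_normK ?num_real // -[leRHS]h.
by rewrite (bigD1 k) //= -expr2 lerDl sumr_ge0 // => l _; rewrite -expr2 sqr_ge0.
Qed.

Lemma pos_lower_bound n (a : 'rV[R]_n) : (forall i, 0 < a 0 i) ->
  exists2 m, 0 < m & forall i, m <= a 0 i.
Proof.
move=> a0; exists (\big[Order.min/1]_i a 0 i).
  by apply: lt_bigmin => // i _; exact: a0.
by move=> i; exact: bigmin_le.
Qed.

(** Rayleigh quotients: if [v] is row [i] of [U], then [b_i = v A v^T + v (B - A) v^T]. The first
    term is at least a lower bound [m] of the spectrum of [A], and [delta] makes the second at most
    [m / 2] in absolute value. *)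
Lemma eigenvalue_lower_bound n (A : Sym R n) : SPD A ->
  exists mu delta, [/\ 0 < mu, 0 < delta & forall (B : Sym R n) U b, `|B - A| < delta ->
    U *m U^T = 1%:M -> symmx B = odiag U b -> forall i, mu <= b 0 i].
Proof.
move=> hA; have [V [a [oV eA]]] := Sym_spectral A.
have [m m0 ma] := pos_lower_bound ((SPD_odiag oV eA).1 hA).
pose d := m / 2 / (n%:R * n%:R + 1).
have d0 : 0 < d by rewrite !divr_gt0 // ltr_wpDl // mulr_ge0.
exists (m / 2), d; split => [|//|B U b BA oU eB i]; first by rewrite divr_gt0.
set v := row i U.
have v1 : `|v| <= 1 by exact: norm_row_orthonormal.
have -> : b 0 i = (v *m A *m v^T) 0 0 + (v *m symmx (B - A) *m v^T) 0 0.
  transitivity ((v *m A *m v^T + v *m symmx (B - A) *m v^T) 0 0); last by rewrite mxE.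
  by rewrite -mulmxDl -mulmxDr symmxB addrC subrK eB row_odiag.
have h1 : m <= (v *m A *m v^T) 0 0.
  rewrite eA quad_odiag; apply: (@le_trans _ _ (\sum_k m * (v *m V^T) 0 k ^+ 2)).
    rewrite -mulr_sumr.
    have -> : \sum_k (v *m V^T) 0 k ^+ 2 = 1; last by rewrite mulr1.
    have u1 : (v *m v^T) 0 0 = 1 by rewrite row_orthonormal // mxE eqxx.
    rewrite -[RHS]u1.
    transitivity (((v *m V^T) *m (v *m V^T)^T) 0 0).
      by rewrite dotmxE; apply: eq_bigr => k _; rewrite expr2.
    by rewrite trmx_mul trmxK mulmxA -(mulmxA _ V^T) (mulmx1C oV) mulmx1.
  by apply: ler_sum => k _; rewrite ler_wpM2r ?sqr_ge0.
have h2 : `|(v *m symmx (B - A) *m v^T) 0 0| <= m / 2.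
  apply: (le_trans (le_mx_norm _ _ _)); apply: (le_trans (mx_norm_mul _ _)).
  have vT : `|v^T| <= 1.
    by apply: mx_norm_le => // j k; rewrite mxE; apply: le_trans v1; exact: le_mx_norm.
  have h3 : `|v *m symmx (B - A)| <= n%:R * d.
    apply: (le_trans (mx_norm_mul _ _)); rewrite -mulrA ler_wpM2l //.
    rewrite -[leRHS]mul1r ler_pM // ltW //; exact: BA.
  apply: (@le_trans _ _ (n%:R * (n%:R * d) * 1)).
    by rewrite ler_pM ?mulr_ge0 // ler_wpM2l.
  rewrite mulr1 mulrA /d mulrCA ler_piMr ?divr_ge0 ?(ltW m0) //.
  by rewrite ler_pdivrMr ?mul1r ?lerDl // ltr_wpDl // mulr_ge0.
by move: h2; rewrite ler_norml => /andP[h2 _]; lra.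
Qed.

Lemma SPD_open n : open (@SPD R n).
Proof.
rewrite openE => A hA; have [mu [d [mu0 d0 h]]] := eigenvalue_lower_bound hA.
apply/nbhs_normP; exists d => //= B; rewrite /ball_ /= distrC => BA.
have [U [b [oU eB]]] := Sym_spectral B.
by apply/(SPD_odiag oU eB) => i; apply: lt_le_trans mu0 _; exact: h BA oU eB i.
Qed.

Lemma differentiable_quadratic (V W : normedModType R) (f : V -> W)
    (df : {linear V -> W}) (x : V) (C K d : R) : 0 < d ->
  (forall h, `|h| < d -> `|f (h + x) - f x - df h| <= C * `|h| ^+ 2) ->
  (forall h, `|df h| <= K * `|h|) ->
  differentiable f x /\ 'd f x = df :> (V -> W).
Proof.
move=> d0 hf hK.
have cdf : continuous df.
  apply: bounded_linear_continuous; apply/linear_boundedP.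
  exists K; split; first exact: num_real.
  by move=> r Kr h; apply: (le_trans (hK h)); rewrite ler_wpM2r // ltW.
have fdf : f \o shift x = cst (f x) + df +o_ 0 id.
  apply/eqaddoP => e e0; apply/nbhs_norm0P.
  (* Below this radius [C |h|^2 <= e |h|], whatever the sign of [C]. *)
  exists (Num.min d (e / (`|C| + 1))).
    by rewrite /= lt_min d0 divr_gt0 // ltr_wpDl.
  move=> h /=; rewrite lt_min => /andP[hd he].
  rewrite !fctE opprD addrA; apply: (le_trans (hf h hd)).
  rewrite expr2 mulrA ler_wpM2r // (le_trans (ler_norm _)) // normrM normr_id.
  move: he; rewrite ltr_pdivlMr ?ltr_wpDl // => /ltW; apply: le_trans.
  by rewrite mulrC ler_wpM2l // lerDl.
have E := diff_unique cdf fdf; split => //.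
by apply/diff_locallyP; rewrite E.
Qed.

End Bounds.

Section DistanceDifferential.
Context (R : realType) (n : nat).
Implicit Types (A B P Q V : Sym R n).

(** The factor [1 / mu] is the Lipschitz constant of [ln] on the eigenvalues; [n] comes from
    bounding the Frobenius norm by the largest entry. *)
Lemma mlog_lipschitz_at A : SPD A -> exists C d, [/\ 0 <= C, 0 < d &
  forall B, `|B - A| < d -> `|mlog B - mlog A| <= C * `|B - A|].
Proof.
move=> hA; have [mu [d [mu0 d0 h]]] := eigenvalue_lower_bound hA.
exists (n%:R / mu), d; split => [|//|B BA]; first by rewrite divr_ge0 // ltW.
have [U [a [oU eA]]] := Sym_spectral A.
have [V [b [oV eB]]] := Sym_spectral B.
have amu i : mu <= a 0 i by apply: (h A U a _ oU eA); rewrite subrr normr0.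
have bmu i : mu <= b 0 i by exact: (h B V b).
have a0 i : 0 < a 0 i by exact: lt_le_trans mu0 (amu i).
have b0 i : 0 < b 0 i by exact: lt_le_trans mu0 (bmu i).
rewrite distrC [X in _ * X]distrC !Sym_normE !symmxB eA eB !mlog_odiag //=.
apply: mx_norm_le => [|i j]; first by rewrite mulr_ge0 // divr_ge0 // ltW.
set X := odiag U _ - odiag V _ => /=.
have sX : X^T = X by rewrite /X raddfB /= !(symm_predP _ (odiag_symm _ _)).
set D := odiag U a - odiag V b.
have sD : D^T = D by rewrite /D raddfB /= !(symm_predP _ (odiag_symm _ _)).
rewrite -(@ler_pXn2r _ 2) ?nnegrE ?mulr_ge0 ?invr_ge0 ?(ltW mu0) //.
rewrite real_normK ?num_real //; apply: (le_trans (sqr_le_tr i j sX)).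
apply: (le_trans (tr_ln_lipschitz oU oV mu0 amu bmu)).
rewrite -/D !exprMn exprVn [n%:R ^+ 2 * _]mulrC -mulrA ler_wpM2l ?invr_ge0 ?exprn_ge0 ?(ltW mu0) //.
by rewrite expr2 -natrM; exact: tr_sqr_le.
Qed.

Lemma tr_mlog_sqr_taylor A : SPD A -> exists C d, [/\ 0 <= C, 0 < d &
  forall B, `|B - A| < d ->
  `|\tr (mlog B *m mlog B) - \tr (mlog A *m mlog A)
    - 2 * \tr (mlog A *m invmx A *m (B - A))| <= C * `|B - A| ^+ 2].
Proof.
move=> hA; have [mu [d [mu0 d0 h]]] := eigenvalue_lower_bound hA.
have [U [a [oU eA]]] := Sym_spectral A.
have amu i : mu <= a 0 i by apply: (h A U a _ oU eA); rewrite subrr normr0.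
have a0 i : 0 < a 0 i by exact: lt_le_trans mu0 (amu i).
pose K := \sum_i `|ln (a 0 i)|.
have K0 : 0 <= K by exact: sumr_ge0.
have aK i : `|ln (a 0 i)| <= K.
  by rewrite /K (bigD1 i) //= lerDl sumr_ge0.
exists ((1 + 2 * K) / mu ^+ 2 * (n * n)%:R), d; split => [|//|B BA].
  by rewrite mulr_ge0 // divr_ge0 ?exprn_ge0 ?(ltW mu0) // addr_ge0 ?mulr_ge0.
have [V [b [oV eB]]] := Sym_spectral B.
have bmu i : mu <= b 0 i by exact: (h B V b).
have b0 i : 0 < b 0 i by exact: lt_le_trans mu0 (bmu i).
rewrite [X in _ * X ^+ 2]distrC Sym_normE !symmxB eA eB !mlog_odiag //= odiag_inv //.
have <- : odiag U (map_mx (fun t => ln t / t) a) =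
    odiag U (map_mx (@ln R) a) *m odiag U (map_mx GRing.inv a).
  by rewrite odiagM //; congr odiag; apply/rowP => i; rewrite !mxE.
set D := odiag U a - odiag V b.
have sD : D^T = D by rewrite /D raddfB /= !(symm_predP _ (odiag_symm _ _)).
apply: (le_trans (tr_ln_sqr_taylor oU oV mu0 amu bmu aK)).
rewrite -[leRHS]mulrA ler_wpM2l ?tr_sqr_le //.
by rewrite divr_ge0 ?exprn_ge0 ?(ltW mu0) // addr_ge0 ?mulr_ge0.
Qed.

(** This is [-2 <log_P Q, V>_P] for the affine-invariant metric, the differential of the squared
    distance to [Q]. *)
Definition dist_sqr_diff Q P V : R :=
  - (2 * \tr (invmx P *m riem_log P Q *m invmx P *m V)).

(** The right-hand side is what the chain rule gives through the linear map [whiten Q]. The two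
    agree by [riem_logE], the identity [S P^-1 = (S^-1 P S^-1)^-1 S^-1] and cyclicity of the
    trace. *)
Lemma dist_sqr_diffE Q P V : SPD Q -> SPD P ->
  dist_sqr_diff Q P V =
  2 * \tr (mlog (whiten Q P) *m invmx (whiten Q P) *m whiten Q V).
Proof.
move=> hQ hP; rewrite /dist_sqr_diff riem_logE // -mulrN; congr (_ * _).
have uS := SPD_unit (msqrtP hQ).1; have uP := SPD_unit hP.
have uA := SPD_unit (SPD_whiten hQ hP).
rewrite mulmxN !mulNmx linearN opprK /=.
set S := msqrt Q in uS uA *; set Y := mlog _.
have e : S *m invmx P = invmx (whiten Q P) *m invmx S.
  have h : whiten Q P *m (S *m invmx P) = invmx S.
    by rewrite /whiten /= -/S !mulmxA mulmxKV // mulmxK.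
  by rewrite -h [RHS]mulmxA (mulVmx uA) mul1mx.
rewrite !mulmxA mulVmx // mul1mx -(mulmxA _ S) e -!mulmxA mxtrace_mulC !mulmxA.
by [].
Qed.

Context (l : nat) (Rs : 'I_l -> Sym R n).

Definition dist_map_diff P V : 'rV[R]_l := \row_i dist_sqr_diff (Rs i) P V.

Lemma dist_map_diff_linear P : linear (dist_map_diff P).
Proof.
move=> c A B; apply/rowP => i; rewrite !mxE /dist_sqr_diff symmxD symmxZ.
by rewrite mulmxDr -scalemxAr mxtraceD mxtraceZ; ring.
Qed.

HB.instance Definition _ P :=
  GRing.isLinear.Build R (Sym R n) 'rV[R]_l _ (dist_map_diff P) (dist_map_diff_linear P).

Lemma differentiable_dist_map P : (forall i, SPD (Rs i)) -> SPD P ->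
  differentiable (dist_map Rs) P /\ 'd (dist_map Rs) P = dist_map_diff P :> (_ -> _).
Proof.
move=> hR hP.
have /fin_all_exists[CD hCD] : forall i, exists Cd : R * R, [/\ 0 <= Cd.1, 0 < Cd.2 &
  forall V, `|V| < Cd.2 -> `|riem_dist (Rs i) (V + P) ^+ 2 - riem_dist (Rs i) P ^+ 2
     - dist_sqr_diff (Rs i) P V| <= Cd.1 * `|V| ^+ 2].
  move=> i; have [C [d [C0 d0 h]]] := tr_mlog_sqr_taylor (SPD_whiten (hR i) hP).
  have [c c0 hc] := whiten_bounded (Rs i).
  (* Pulling back along [whiten], which is bounded by [c], divides the radius by [c] and multiplies
     the quadratic constant by [c^2]. *)
  exists (C * c ^+ 2, d / c); split => /= [||V Vd].
  - by rewrite mulr_ge0 // exprn_ge0 // ltW.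
  - exact: divr_gt0.
  have e : whiten (Rs i) (V + P) - whiten (Rs i) P = whiten (Rs i) V.
    by rewrite linearD addrK.
  rewrite !riem_dist_sqr dist_sqr_diffE // -[in X in _ * X]e.
  have := h (whiten (Rs i) (V + P)); rewrite e.
  move=> /(_ _)/le_trans; apply.
    by apply: le_lt_trans (hc V) _; rewrite mulrC -ltr_pdivlMr.
  rewrite -mulrA ler_wpM2l // -exprMn lerXn2r ?nnegrE ?mulr_ge0 ?(ltW c0) //.
have hK : exists K, forall V, `|dist_map_diff P V| <= K * `|V|.
  pose M i := invmx P *m riem_log P (Rs i) *m invmx P.
  exists (\sum_i 2 * (n%:R * (n%:R * `|M i|))) => V; apply: mx_norm_le => [|k i].
    by rewrite mulr_ge0 // sumr_ge0 // => i _; rewrite !mulr_ge0.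
  rewrite ord1 mxE /dist_sqr_diff normrN normrM ger0_norm //.
  apply: (@le_trans _ _ (2 * (n%:R * (n%:R * `|M i|)) * `|V|)).
    rewrite -!mulrA ler_pM2l //; apply: (le_trans (norm_trace _)).
    by rewrite ler_wpM2l // mulrA; exact: mx_norm_mul.
  rewrite ler_wpM2r // (bigD1 i) //= lerDl sumr_ge0 // => j _; rewrite !mulr_ge0 //.
have [K {}hK] := hK.
apply: (@differentiable_quadratic _ _ _ _ (dist_map_diff P) _ (\sum_i (CD i).1) K
  (\big[Order.min/1]_i (CD i).2)) => // [|V].
  by apply: lt_bigmin => // i _; have [] := hCD i.
move=> hV; apply: mx_norm_le => [|k i].
  by rewrite mulr_ge0 ?exprn_ge0 // sumr_ge0 // => i _; have [] := hCD i.
rewrite ord1 !mxE; have [_ _ h] := hCD i.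
apply: (le_trans (h V _)); first by apply: (lt_le_trans hV); exact: bigmin_le.
rewrite ler_wpM2r ?exprn_ge0 // (bigD1 i) //= lerDl sumr_ge0 // => j _.
by have [] := hCD j.
Qed.

(** Definiteness of the metric: by cyclicity the trace is that of [W^2] with
    [W = P^(-1/2) V P^(-1/2)] symmetric, so every entry of [W] is zero. *)
Lemma tr_inv_eq0 P V : SPD P -> \tr (invmx P *m V *m invmx P *m V) = 0 -> V = 0.
Proof.
move=> hP; have [hK KK] := msqrtP hP; have uK := SPD_unit hK.
have eP : invmx P = invmx (msqrt P) *m invmx (msqrt P).
  have h : P *m (invmx (msqrt P) *m invmx (msqrt P)) = 1%:M.
    by rewrite -KK mulmxA mulmxK // mulmxV.
  by rewrite -[RHS]mul1mx -(mulVmx (SPD_unit hP)) -mulmxA h mulmx1.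
set J := invmx (msqrt P) in eP *.
have -> : \tr (invmx P *m V *m invmx P *m V) =
    \tr (sandwich (isym (msqrt P)) V *m sandwich (isym (msqrt P)) V).
  by rewrite eP /= -/J -!mulmxA mxtrace_mulC !mulmxA.
move=> h.
have W0 : symmx (sandwich (isym (msqrt P)) V) = 0.
  apply/matrixP => i j; rewrite [RHS]mxE; apply/eqP; rewrite -sqrf_eq0 eq_le sqr_ge0.
  by rewrite andbT -h sqr_le_tr // symmxT.
apply: val_inj => /=.
have := congr1 (fun X => msqrt P *m X *m msqrt P) W0 => /=.
by rewrite mulmx0 mul0mx !mulmxA mulmxV // mul1mx mulmxKV.
Qed.

Lemma locally_invertible_regular P : (forall i, SPD (Rs i)) ->
  log_regular Rs P -> locally_invertible_at (dist_map Rs) P.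
Proof.
move=> hR [hP nsing]; have [dF eF] := differentiable_dist_map hR hP.
split => //.
have full : (fullv <= <<[tuple riem_log P (Rs i) | i < l]>>)%VS.
  rewrite -(dimv_leqif_sup (subvf _)) eqn_leq dimvS ?subvf //= dim_Sym leqNgt.
  by apply/negP => lt; exact: nsing.
have := limg_ker_dim (linfun ('d (dist_map Rs) P)) fullv.
rewrite capfv dim_Sym => <-; rewrite (_ : lker _ = 0%VS) ?dimv0 //.
apply/eqP/lker0P => V1 V2; rewrite !lfunE /= eF => e12.
apply/eqP; rewrite -subr_eq0; apply/eqP; set V := V1 - V2.
have dV : dist_map_diff P V = 0 by rewrite linearB /= e12 subrr.
apply: (tr_inv_eq0 hP).
have VE := coord_span (subvP full V (memvf V)).
have dVi i : \tr (invmx P *m riem_log P (Rs i) *m invmx P *m V) = 0.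
  have /eqP := congr1 (fun u : 'rV_l => u 0 i) dV.
  by rewrite !mxE oppr_eq0 mulf_eq0 pnatr_eq0 /= => /eqP.
(* Only one of the two occurrences of [V] is expanded; each resulting term pairs some
   [riem_log P (Rs i)] with [V] and vanishes. *)
have {1}-> : symmx V = \sum_(i < l) coord [tuple riem_log P (Rs i) | i < l] i V *:
    symmx (riem_log P (Rs i)).
  rewrite {1}VE (big_morph (@symmx R n) (@symmxD R n) erefl).
  by apply: eq_bigr => i _; rewrite symmxZ -tnth_nth tnth_mktuple.
rewrite mulmx_sumr !mulmx_suml raddf_sum big1 // => i _.
by rewrite -scalemxAr -!scalemxAl /= mxtraceZ dVi mulr0.
Qed.

End DistanceDifferential.

(** * Analytic functions of one variable *)

Section Majorant.
Context (R : realType).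
Implicit Types (p q : {poly R}) (r x z : R) (f g : R -> R).

(** For [r >= 0], a weighted l1 norm of the coefficients: submultiplicative, above the sup norm on
    [-r, r], and stable under division by a linear factor with a constant independent of the
    degree. *)
Definition majorant r q : R := (map_poly Num.norm q).[r].

Lemma majorantE r q k : (size q <= k)%N -> majorant r q = \sum_(i < k) `|q`_i| * r ^+ i.
Proof.
move=> qk; rewrite /majorant (@horner_coef_wide _ k).
  by apply: eq_bigr => i _; rewrite coef_map_id0 ?normr0.
by apply: leq_trans qk; exact: size_poly.
Qed.

Lemma majorant_ge0 r q : 0 <= r -> 0 <= majorant r q.
Proof.
by move=> r0; rewrite (majorantE r (leqnn _)) sumr_ge0 // => i _; rewrite mulr_ge0 ?exprn_ge0.
Qed.

Lemma majorantC r c : majorant r c%:P = `|c|.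
Proof.
rewrite /majorant (_ : map_poly _ _ = `|c|%:P) ?hornerC //.
by apply/polyP => i; rewrite coef_map_id0 ?normr0 // !coefC; case: eqP; rewrite ?normr0.
Qed.

Lemma majorantXM r q : majorant r ('X * q) = r * majorant r q.
Proof.
rewrite /majorant (_ : map_poly _ ('X * q) = 'X * map_poly Num.norm q) ?hornerM ?hornerX //.
by apply/polyP => -[|i]; rewrite !(coef_map_id0, coefXM) ?normr0.
Qed.

Lemma majorantZ r c q : majorant r (c%:P * q) = `|c| * majorant r q.
Proof.
rewrite /majorant (_ : map_poly _ (c%:P * q) = `|c|%:P * map_poly Num.norm q).
  by rewrite hornerM hornerC.
by apply/polyP => i; rewrite !(coef_map_id0, coefCM) ?normr0 // normrM.
Qed.

Lemma majorantN r q : majorant r (- q) = majorant r q.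
Proof. by rewrite -mulN1r -polyCN majorantZ normrN normr1 mul1r. Qed.

Lemma majorantD r p q : 0 <= r -> majorant r (p + q) <= majorant r p + majorant r q.
Proof.
move=> r0; pose k := maxn (size p) (size q).
rewrite (@majorantE _ (p + q) k) ?size_polyD // (@majorantE _ p k) ?leq_maxl //.
rewrite (@majorantE _ q k) ?leq_maxr // -big_split /=; apply: ler_sum => i _.
by rewrite coefD -mulrDl ler_wpM2r ?exprn_ge0 // ler_normD.
Qed.

Lemma majorantM r p q : 0 <= r -> majorant r (p * q) <= majorant r p * majorant r q.
Proof.
move=> r0; rewrite {2 3}/majorant -hornerM.
pose k := maxn (size (p * q)) (size (map_poly Num.norm p * map_poly Num.norm q)).
rewrite (@majorantE _ _ k) ?leq_maxl // (@horner_coef_wide _ k) ?leq_maxr //.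
apply: ler_sum => i _; rewrite ler_wpM2r ?exprn_ge0 // !coefM.
apply: (le_trans (ler_norm_sum _ _ _)); apply: ler_sum => j _.
by rewrite normrM !coef_map_id0 ?normr0.
Qed.

Lemma majorant_sum r I (t : seq I) (P : pred I) (F : I -> {poly R}) : 0 <= r ->
  majorant r (\sum_(i <- t | P i) F i) <= \sum_(i <- t | P i) majorant r (F i).
Proof.
move=> r0; elim/big_rec2: _ => [|i u v _ uv]; first by rewrite majorantC normr0.
by apply: (le_trans (majorantD _ _ r0)); rewrite lerD2l.
Qed.

Lemma horner_le_majorant r q x : `|x| <= r -> `|q.[x]| <= majorant r q.
Proof.
move=> xr; rewrite (majorantE r (leqnn _)) horner_coef.
apply: (le_trans (ler_norm_sum _ _ _)); apply: ler_sum => i _.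
by rewrite normrM normrX ler_wpM2l // lerXn2r // nnegrE // (le_trans _ xr).
Qed.

Lemma majorant_mono r r' q : 0 <= r' -> r' <= r -> majorant r' q <= majorant r q.
Proof.
move=> r0 rr; rewrite !(majorantE _ (leqnn _)); apply: ler_sum => i _.
by rewrite ler_wpM2l // lerXn2r // nnegrE // (le_trans r0).
Qed.

(* A function is analytic near [0] in the sense needed here if it is a uniform limit
   on [-r, r] of polynomials [q] whose majorants [sum_i |q_i| r^i] stay bounded. *)
Definition approx r N f := forall e, 0 < e ->
  exists q, majorant r q <= N /\ forall x, `|x| <= r -> `|f x - q.[x]| <= e.

Definition analytic_at f (a : R) := exists r N, 0 < r /\ approx r N (fun x => f (a + x)).

Lemma approx_mono r r' N f : 0 <= r' -> r' <= r -> approx r N f -> approx r' N f.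
Proof.
move=> r0 rr hf e e0; have [q [qN hq]] := hf e e0; exists q; split.
  exact: le_trans (majorant_mono _ r0 rr) qN.
by move=> x xr; apply: hq; exact: le_trans xr rr.
Qed.

Lemma approx_ge0 r N f : 0 <= r -> approx r N f -> 0 <= N.
Proof.
by move=> r0 /(_ 1 ltr01)[q [+ _]]; apply: le_trans; exact: majorant_ge0.
Qed.

Lemma approx_bound r N f x : 0 <= r -> approx r N f -> `|x| <= r -> `|f x| <= N.
Proof.
move=> r0 hf xr; apply/ler_addgt0Pr => e e0; have [q [qN hq]] := hf e e0.
rewrite -[f x](subrK q.[x]) addrC; apply: (le_trans (ler_normD _ _)).
by rewrite lerD ?hq // (le_trans (horner_le_majorant _ xr)).
Qed.

Lemma approxD r N M f g : 0 <= r -> approx r N f -> approx r M g ->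
  approx r (N + M) (fun x => f x + g x).
Proof.
move=> r0 hf hg e e0; have e20 : 0 < e / 2 by rewrite divr_gt0.
have [p [pN hp]] := hf _ e20; have [q [qM hq]] := hg _ e20.
exists (p + q); split; first by apply: (le_trans (majorantD _ _ r0)); rewrite lerD.
move=> x xr; rewrite hornerD opprD addrACA; apply: (le_trans (ler_normD _ _)).
by rewrite [leRHS]splitr lerD ?hp ?hq.
Qed.

Lemma approxM r N M f g : 0 <= r -> approx r N f -> approx r M g ->
  approx r (N * M) (fun x => f x * g x).
Proof.
move=> r0 hf hg e e0; have N0 := approx_ge0 r0 hf; have M0 := approx_ge0 r0 hg.
have d0 : 0 < e / (N + M + 1) by rewrite divr_gt0 // ltr_wpDl // addr_ge0.
have [p [pN hp]] := hf _ d0; have [q [qM hq]] := hg _ d0.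
exists (p * q); split.
  by apply: (le_trans (majorantM _ _ r0)); rewrite ler_pM ?majorant_ge0.
move=> x xr; rewrite hornerM.
have -> : f x * g x - p.[x] * q.[x] = f x * (g x - q.[x]) + (f x - p.[x]) * q.[x] by ring.
apply: (le_trans (ler_normD _ _)); rewrite !normrM.
apply: (@le_trans _ _ (N * (e / (N + M + 1)) + e / (N + M + 1) * M)).
  apply: lerD; apply: ler_pM => //; rewrite ?hq ?hp //; first exact: approx_bound hf xr.
  by apply: le_trans qM; exact: horner_le_majorant.
rewrite mulrC -mulrDr mulrAC ler_pdivrMr ?ltr_wpDl ?addr_ge0 //.
by rewrite ler_wpM2l ?(ltW e0) // lerDl.
Qed.

Lemma analytic_cst (c a : R) : analytic_at (fun=> c) a.
Proof.
exists 1, `|c|; split => // e e0; exists c%:P; rewrite majorantC; split => // x _.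
by rewrite hornerC subrr normr0 ltW.
Qed.

Lemma analytic_affine (b c a : R) : analytic_at (fun x => b + x * c) a.
Proof.
exists 1, (majorant 1 ((b + a * c)%:P + 'X * c%:P)); split => // e e0.
exists ((b + a * c)%:P + 'X * c%:P); split => // x _.
rewrite !hornerE (_ : _ - _ = 0) ?normr0 ?ltW //; ring.
Qed.

Lemma analytic_op2 f g a (op : R -> R -> R) (op' : R -> R -> R) :
  (forall r N M f g, 0 <= r -> approx r N f -> approx r M g ->
     approx r (op' N M) (fun x => op (f x) (g x))) ->
  analytic_at f a -> analytic_at g a -> analytic_at (fun x => op (f x) (g x)) a.
Proof.
move=> h [r [N [r0 hf]]] [s [M [s0 hg]]]; exists (Num.min r s), (op' N M).
have m0 : 0 < Num.min r s by rewrite lt_min r0.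
split => //; apply: (h _ _ _ (fun x => f (a + x)) (fun x => g (a + x)) (ltW m0)).
  by apply: approx_mono hf; rewrite ?(ltW m0) // ge_min lexx.
by apply: approx_mono hg; rewrite ?(ltW m0) // ge_min lexx orbT.
Qed.

Lemma analyticD f g a : analytic_at f a -> analytic_at g a -> analytic_at (fun x => f x + g x) a.
Proof. exact: analytic_op2 approxD. Qed.

Lemma analyticM f g a : analytic_at f a -> analytic_at g a -> analytic_at (fun x => f x * g x) a.
Proof. exact: analytic_op2 approxM. Qed.

Lemma analytic_sum I (t : seq I) (P : pred I) (F : I -> R -> R) a :
  (forall i, analytic_at (F i) a) -> analytic_at (fun x => \sum_(i <- t | P i) F i x) a.
Proof.
move=> hF; elim: t => [|i t IH].
  by under eq_fun do rewrite big_nil; exact: analytic_cst.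
under eq_fun do rewrite big_cons; case: (P i) => //.
exact: analyticD.
Qed.

Lemma analytic_prod I (t : seq I) (P : pred I) (F : I -> R -> R) a :
  (forall i, analytic_at (F i) a) -> analytic_at (fun x => \prod_(i <- t | P i) F i x) a.
Proof.
move=> hF; elim: t => [|i t IH].
  by under eq_fun do rewrite big_nil; exact: analytic_cst.
under eq_fun do rewrite big_cons; case: (P i) => //.
exact: analyticM.
Qed.

Lemma analytic_det n (M : R -> 'M[R]_n) a :
  (forall i j, analytic_at (fun x => M x i j) a) -> analytic_at (fun x => \det (M x)) a.
Proof.
move=> hM; apply: analytic_sum => s; apply: analyticM; first exact: analytic_cst.
by apply: analytic_prod => i.
Qed.

Lemma analytic_mulmx m n k (M : R -> 'M[R]_(m, n)) (N : R -> 'M[R]_(n, k)) a :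
  (forall i j, analytic_at (fun x => M x i j) a) -> (forall i j, analytic_at (fun x => N x i j) a) ->
  forall i j, analytic_at (fun x => (M x *m N x) i j) a.
Proof.
move=> hM hN i j; under eq_fun do rewrite mxE.
by apply: analytic_sum => l; exact: analyticM.
Qed.

Lemma seq_lower_bound (t : seq R) : (forall y, y \in t -> 0 < y) ->
  exists2 d, 0 < d & forall y, y \in t -> d <= y.
Proof.
elim: t => [|y t IH] ht; first by exists 1.
have [|d d0 hd] := IH; first by move=> z zt; apply: ht; rewrite inE zt orbT.
exists (Num.min d y); first by rewrite lt_min d0 ht ?mem_head.
move=> z; rewrite inE => /orP[/eqP->|/hd dz]; rewrite ge_min ?lexx ?orbT //.
by rewrite dz.
Qed.

(** Writing [m] for the majorant, the identity [X s = (q - q(z)) + z s] gives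
    [r m(s) <= 2 m(q) + |z| m(s)], and [|z| <= r / 2] lets the left side absorb the last term. *)
Lemma divide_root r q z : 0 < r -> `|z| <= r / 2 ->
  exists s, q = q.[z]%:P + s * ('X - z%:P) /\ majorant r s <= 4 / r * majorant r q.
Proof.
move=> r0 zr; have zr' : `|z| <= r by lra.
have /factor_theorem[s es] : root (q - q.[z]%:P) z by rewrite /root !hornerE subrr.
exists s; split; first by rewrite -es addrC subrK.
have h1 : r * majorant r s <= majorant r (q - q.[z]%:P) + `|z| * majorant r s.
  rewrite -majorantXM -majorantZ es.
  rewrite (_ : 'X * s = s * ('X - z%:P) + z%:P * s); last by ring.
  exact: majorantD (ltW r0).
have h2 : majorant r (q - q.[z]%:P) <= 2 * majorant r q.
  apply: (le_trans (majorantD _ _ (ltW r0))); rewrite majorantN majorantC.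
  by have := horner_le_majorant q zr'; lra.
have h3 : `|z| * majorant r s <= r / 2 * majorant r s.
  by rewrite ler_wpM2r // majorant_ge0 // ltW.
rewrite mulrAC ler_pdivlMr //; lra.
Qed.

(* A polynomial with bounded majorant and small at the points of [t] is close to
   a multiple of [\prod_(z <- t) ('X - z%:P)] with a bounded quotient. *)
Lemma small_at_roots r (t : seq R) N v x : 0 < r -> uniq t ->
  (forall z, z \in t -> `|z| <= r / 2) -> `|x| <= r ->
  (forall e, 0 < e -> exists q, [/\ majorant r q <= N,
     forall z, z \in t -> `|q.[z]| <= e & `|q.[x] - v| <= e]) ->
  `|v| <= N * \prod_(z <- t) (4 / r * `|x - z|).
Proof.
move=> r0; elim: t N v => [|z t IH] N v /=.
  move=> _ _ xr h; rewrite big_nil mulr1; apply/ler_addgt0Pr => e e0.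
  have [q [qN _ hq]] := h e e0.
  rewrite -[v](subrK q.[x]) addrC; apply: (le_trans (ler_normD _ _)).
  by rewrite distrC lerD // (le_trans (horner_le_majorant _ xr)).
move=> /andP[zt ut] tr xr h; rewrite big_cons.
have [xz|xz] := eqVneq x z.
  rewrite xz subrr normr0 mulr0 mul0r mulr0; apply/ler_addgt0Pr => e e0.
  have [q [_ hq1 hq2]] := h (e / 2) (divr_gt0 e0 (ltr0n _ 2)).
  rewrite add0r -[v](subrK q.[x]) [leRHS]splitr; apply: (le_trans (ler_normD _ _)).
  by rewrite distrC lerD // xz hq1 // mem_head.
have xz0 : 0 < `|x - z| by rewrite normr_gt0 subr_eq0.
(* [d] separates [z] from [x] and from the other roots, so errors of [e d / 2] for [q] become errors
   of at most [e] after division by [X - z]. *)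
have [|d d0 hd] := @seq_lower_bound (`|x - z| :: [seq `|y - z| | y <- t]).
  move=> y; rewrite inE => /orP[/eqP->//|/mapP[w wt ->]].
  by rewrite normr_gt0 subr_eq0; apply: contraNneq zt => <-.
have := IH (4 / r * N) (v / (x - z)) ut.
have t' w : w \in t -> `|w| <= r / 2 by move=> wt; apply: tr; rewrite inE wt orbT.
move=> /(_ t' xr) IH'.
suff : `|v / (x - z)| <= 4 / r * N * \prod_(w <- t) (4 / r * `|x - w|).
  rewrite normrM normfV ler_pdivrMr // => /le_trans; apply.
  by rewrite le_eqVlt; apply/orP; left; apply/eqP; ring.
apply: IH' => e e0.
have ed0 : 0 < e * d / 2 by rewrite !mulr_gt0 // invr_gt0.
have [q [qN hq1 hq2]] := h _ ed0.
have zr : `|z| <= r / 2 by apply: tr; rewrite mem_head.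
have [s [es sN]] := divide_root q r0 zr.
have qz : `|q.[z]| <= e * d / 2 by apply: hq1; rewrite mem_head.
have key w u : d <= `|w - z| -> `|q.[w] - u| <= e * d / 2 -> `|s.[w] - u / (w - z)| <= e.
  move=> dw hw; have w0 : w - z != 0 by rewrite -normr_gt0 (lt_le_trans d0).
  have -> : s.[w] - u / (w - z) = (q.[w] - u - q.[z]) / (w - z).
    by rewrite [in q.[w]]es !hornerE; field.
  rewrite normrM normfV ler_pdivrMr ?normr_gt0 //.
  apply: (le_trans (ler_normB _ _)); apply: (@le_trans _ _ (e * d)).
    by rewrite [leRHS]splitr lerD.
  by rewrite ler_wpM2l // ltW.
exists s; split.
- by apply: (le_trans sN); rewrite ler_wpM2l // divr_ge0 // ltW.
- move=> w wt; have := key w 0; rewrite mul0r !subr0; apply.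
    by apply: hd; rewrite inE; apply/orP; right; apply/mapP; exists w.
  by apply: hq1; rewrite inE wt orbT.
- by apply: key => //; apply: hd; rewrite mem_head.
Qed.

(** The zeros [z] and the point [x] lie within [r / 16] of the origin, so each factor
    [4 / r * |x - z|] is at most [1 / 2]. Using [k] zeros gives [|f x| <= N / 2^k], for every
    [k]. *)
Lemma approx_identity r N f : 0 < r -> approx r N f ->
  infinite_set [set x | `|x| <= r / 16 /\ f x = 0] ->
  forall x, `|x| <= r / 16 -> f x = 0.
Proof.
move=> r0 hf inf x xr.
have N0 := approx_ge0 (ltW r0) hf.
have bound k : `|f x| <= N * 2^-1 ^+ k.
  have [B BZ kB] := infinite_set_fset k inf.
  have Bz z : z \in finmap.enum_fset B -> `|z| <= r / 16 /\ f z = 0 by move=> zB; exact: (BZ z).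
  apply: (@le_trans _ _ (N * \prod_(z <- finmap.enum_fset B) (4 / r * `|x - z|))).
    apply: small_at_roots => //; first exact: finmap.fset_uniq.
    - by move=> z /Bz[zr _]; lra.
    - lra.
    move=> e e0; have [q [qN hq]] := hf e e0; exists q; split => //.
      by move=> z /Bz[zr fz]; have := hq z; rewrite fz sub0r normrN; apply; lra.
    by rewrite distrC; apply: hq; lra.
  rewrite ler_wpM2l //; apply: (@le_trans _ _ (\prod_(z <- finmap.enum_fset B) 2^-1)).
    rewrite big_seq [leRHS]big_seq; apply: ler_prod => z /Bz[zr _]; apply/andP; split.
      by rewrite mulr_ge0 // divr_ge0 // ltW.
    have : `|x - z| <= r / 8 by apply: (le_trans (ler_normB _ _)); lra.
    by move=> h; rewrite mulrAC ler_pdivrMr //; lra.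
  rewrite big_const_seq count_predT iter_mulr mulr1.
  by rewrite ler_wiXn2l ?invr_ge0 // invf_le1 // ler1n.
apply/eqP; rewrite -normr_le0; apply/ler_addgt0Pr => e e0; rewrite add0r.
have c0 : (fun k => N * 2^-1 ^+ k) @ \oo --> (N * 0 : R).
  by apply: cvgMl_tmp; apply: cvg_expr; rewrite gtr0_norm ?invr_gt0 // invf_lt1 // ltr1n.
have [k _ hk] := (cvgrPdist_lt _ _).1 c0 e e0.
apply: (le_trans (bound k)); have := hk k (leqnn k); rewrite mulr0 sub0r normrN => /ltW.
exact/le_trans/ler_norm.
Qed.

Lemma infinite_itvcc (u v : R) : u < v -> infinite_set [set x | u <= x <= v].
Proof.
move=> uv fin; apply: infinite_nat.
pose g (k : nat) := u + (v - u) / k.+1%:R.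
have ginj : injective g.
  move=> j k /addrI /mulfI; rewrite subr_eq0 gt_eqF // => /(_ isT) /invr_inj /eqP.
  by rewrite eqr_nat => /eqP[].
rewrite (_ : [set: nat] = g @^-1` [set x | u <= x <= v]); last first.
  apply/seteqP; split => // k _ /=; rewrite /g lerDl divr_ge0 ?subr_ge0 ?(ltW uv) //=.
  by rewrite addrC -lerBrDr ler_piMr ?subr_ge0 ?(ltW uv) // invf_le1 // ler1n.
by apply: finite_preimage fin => i j _ _; exact: ginj.
Qed.

(** Let [c] be the supremum of the [s] with finitely many zeros in [[0, s]]. Finitely many zeros
    around [c] would push the supremum further or reach [1]. Infinitely many make [f] vanish near
    [c], and this neighbourhood contains either [0] or a whole interval below some [e] in [E]. *)
Lemma analytic_finite_zeros f : (forall a, 0 <= a <= 1 -> analytic_at f a) -> f 0 != 0 ->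
  finite_set [set x | 0 <= x <= 1 /\ f x = 0].
Proof.
move=> hf f0.
pose Z s := [set x | 0 <= x <= s /\ f x = 0].
pose E := [set s | 0 <= s <= 1 /\ finite_set (Z s)].
have ZS s t : s <= t -> Z s `<=` Z t.
  by move=> st x [/andP[x0 xs] fx]; split => //; rewrite x0 (le_trans xs).
have E0 : E 0.
  split; first by rewrite lexx ler01.
  apply: (sub_finite_set _ (finite_set1 0)) => x [/andP[x0 x1] _] /=.
  by apply/eqP; rewrite eq_le x0 x1.
have ubE : ubound E 1 by move=> s [/andP[]].
have supE : has_sup E by split; [exists 0|exists 1].
set c := sup E.
have c0 : 0 <= c by exact: sup_upper_bound.
have c1 : c <= 1 by apply: ge_sup => //; exists 0.
have [r [N [r0 hr]]] : analytic_at f c by apply: hf; rewrite c0.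
pose d := r / 16; have d0 : 0 < d by rewrite divr_gt0.
have [e Ee ce] := sup_adherent d0 supE; rewrite -/c in ce.
have [/andP[e0 e1] fine] := Ee.
have ec : e <= c by exact: sup_upper_bound.
have [fin|inf] := pselect (finite_set [set x | `|x| <= d /\ f (c + x) = 0]).
  have cd t : t <= c + d -> finite_set (Z t).
    move=> td; apply: (sub_finite_set _ (_ : finite_set
      (Z e `|` ((fun x => c + x) @` [set x | `|x| <= d /\ f (c + x) = 0])))).
      move=> x [/andP[x0 xt] fx]; have [xe|ex] := leP x e; [left|right].
        by split => //; rewrite x0.
      exists (x - c); last by rewrite addrC subrK.
      split; last by rewrite addrC subrK.
      rewrite ler_norml; apply/andP; split; lra.
    by rewrite finite_setU; split => //; exact: finite_image.
  have [//|lt1] := leP 1 (c + d); first exact: cd.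
  have : E (c + d) by split; [rewrite addr_ge0 ?(ltW d0) //= ltW|exact: cd].
  by move/(sup_upper_bound supE); rewrite -/c; lra.
have fz := approx_identity r0 hr inf.
case/eqP: f0; have [dc|cd] := leP c d.
  by have := fz (- c); rewrite subrr; apply; rewrite normrN ger0_norm.
have /infinite_itvcc [] : c - d < e by [].
apply: sub_finite_set fine => x /andP[xc xe]; split; first by rewrite xe andbT; lra.
by rewrite -(subrK c x) addrC; apply: fz; rewrite ler_norml; apply/andP; split; rewrite -/d; lra.
Qed.

End Majorant.

(** * Analyticity of the matrix logarithm along lines *)

Section LogAnalytic.
Context (R : realType).

(** By the geometric sum, the derivative of the function inside the absolute value is
    [(1 - x)^m / x]; the function vanishes at [1], and the mean value theorem on [[b, 1]]
    concludes. *)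
Lemma ln_partial_sum (b : R) m : 0 < b -> b <= 1 ->
  `|ln b + \sum_(k < m) k.+1%:R^-1 * (1 - b) ^+ k.+1| <= (1 - b) ^+ m / b.
Proof.
move=> b0 b1.
pose q : {poly R} := \sum_(k < m) k.+1%:R^-1%:P * (1 - 'X) ^+ k.+1.
pose f : R -> R := @ln R + horner q.
have qE x : q.[x] = \sum_(k < m) k.+1%:R^-1 * (1 - x) ^+ k.+1.
  by rewrite /q horner_sum; apply: eq_bigr => k _; rewrite !hornerE.
have dq x : q^`().[x] = - \sum_(k < m) (1 - x) ^+ k.
  rewrite /q raddf_sum horner_sum -sumrN; apply: eq_bigr => k _ /=.
  rewrite derivM derivC mul0r add0r deriv_exp derivB derivX derivC sub0r.
  rewrite !hornerE hornerMn !hornerE -[_ * _ *+ _]mulr_natl mulrA mulVf ?pnatr_eq0 //.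
  by rewrite mul1r mulN1r.
have df (x : R) : 0 < x -> is_derive x 1 f (x^-1 - \sum_(k < m) (1 - x) ^+ k).
  by move=> x0; rewrite -dq; have ? := is_derive1_ln x0; apply: is_deriveD.
have [c cb fc] : exists2 c, c \in `[b, 1]%R & f 1 - f b = (c^-1 - \sum_(k < m) (1 - c) ^+ k) * (1 - b).
  apply: (@MVT_segment _ f (fun c => c^-1 - \sum_(k < m) (1 - c) ^+ k)) => //.
    by move=> x; rewrite in_itv /= => /andP[bx _]; apply: df; exact: lt_trans bx.
  apply: derivable_within_continuous => x; rewrite in_itv /= => /andP[bx _].
  by apply: ex_derive; apply: df; exact: lt_le_trans bx.
move: cb; rewrite in_itv /= => /andP[bc c1].
have c0 : 0 < c by exact: lt_le_trans bc.
have f1 : f 1 = 0.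
  rewrite /f fctE ln1 add0r qE big1 // => k _.
  by rewrite subrr expr0n mulr0.
have gc : c^-1 - \sum_(k < m) (1 - c) ^+ k = (1 - c) ^+ m / c.
  have := subrX1 (1 - c) m; rewrite (_ : 1 - c - 1 = - c); last by ring.
  by move/eqP; rewrite subr_eq => /eqP ->; field; rewrite gt_eqF.
rewrite -qE -[_ + _]/(f b) -normrN -[- f b]add0r -f1 fc gc ger0_norm; last first.
  by rewrite mulr_ge0 ?subr_ge0 // divr_ge0 ?exprn_ge0 ?subr_ge0 // ltW.
apply: (@le_trans _ _ ((1 - c) ^+ m / c)).
  by rewrite ler_piMr ?divr_ge0 ?exprn_ge0 ?subr_ge0 ?(ltW c0) // lerBlDr lerDl ltW.
apply: ler_pM; rewrite ?exprn_ge0 ?subr_ge0 ?invr_ge0 ?(ltW c0) //.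
  by rewrite lerXn2r ?nnegrE ?subr_ge0 // lerB.
by rewrite lef_pV2 ?posrE.
Qed.

(** The largest row sum of majorants is a submultiplicative norm on polynomial matrices; bounding
    single entries instead would lose a factor [n] at each multiplication. *)
Lemma majorant_mxX n (N : 'M[{poly R}]_n) (r nu : R) k : 0 <= r -> 0 <= nu ->
  (forall i, \sum_j majorant r (N i j) <= nu) ->
  forall i, \sum_j majorant r ((N ^+ k) i j) <= nu ^+ k.
Proof.
move=> r0 nu0 hN; elim: k => [|k IH] i.
  rewrite !expr0 (bigD1 i) //= big1 ?addr0 => [|j ji].
    by rewrite mxE eqxx majorantC normr1.
  by rewrite mxE eq_sym (negbTE ji) majorantC normr0.
rewrite !exprS -[N * _]/(N *m _).
apply: (@le_trans _ _ (\sum_j \sum_l majorant r (N i l) * majorant r ((N ^+ k) l j))).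
  apply: ler_sum => j _; rewrite mxE; apply: (le_trans (majorant_sum _ _ _ r0)).
  by apply: ler_sum => l _; exact: majorantM.
rewrite exchange_big /=.
apply: (@le_trans _ _ (\sum_l majorant r (N i l) * nu ^+ k)).
  by apply: ler_sum => l _; rewrite -mulr_sumr ler_wpM2l // majorant_ge0.
by rewrite -mulr_suml ler_wpM2r // exprn_ge0.
Qed.

Lemma majorant_mxX_entry n (N : 'M[{poly R}]_n) (r nu : R) k i j : 0 <= r -> 0 <= nu ->
  (forall i, \sum_j majorant r (N i j) <= nu) -> majorant r ((N ^+ k) i j) <= nu ^+ k.
Proof.
move=> r0 nu0 hN; apply: le_trans (majorant_mxX k r0 nu0 hN i).
by rewrite (bigD1 j) //= lerDl sumr_ge0 // => l _; exact: majorant_ge0.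
Qed.

Lemma map_mx_hornerX n (N : 'M[{poly R}]_n) x k :
  map_mx (horner_eval x) (N ^+ k) = map_mx (horner_eval x) N ^+ k.
Proof.
elim: k => [|k IH]; first by rewrite !expr0 -[1 in LHS]/(1%:M) map_mx1.
by rewrite !exprS -[N * _]/(N *m _) map_mxM IH.
Qed.

Lemma conj_mxX n (U B : 'M[R]_n) k : U *m U^T = 1%:M ->
  U^T *m (U *m B *m U^T) ^+ k *m U = B ^+ k.
Proof.
move=> oU; have oU' := mulmx1C oU; elim: k => [|k IH].
  by rewrite !expr0 -[1 in LHS]/(1%:M) mulmx1.
rewrite !exprS -IH -[_ * _ in LHS]/(_ *m _) -[_ * _ in RHS]/(_ *m _) !mulmxA.
by rewrite oU' mul1mx.
Qed.

Lemma odiag_le_norm n (U : 'M[R]_n) (B : Sym R n) b i : U *m U^T = 1%:M ->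
  symmx B = odiag U b -> b 0 i <= n%:R * (n%:R * `|B|).
Proof.
move=> oU eB; rewrite -(row_odiag b i oU) -eB; apply: (le_trans (ler_norm _)).
have v1 := norm_row_orthonormal i oU.
have vT : `|(row i U)^T| <= 1.
  by apply: mx_norm_le => // j k; rewrite mxE; apply: le_trans v1; exact: le_mx_norm.
apply: (le_trans (le_mx_norm _ _ _)); apply: (le_trans (mx_norm_mul _ _)).
rewrite -mulrA ler_wpM2l // -[leRHS]mulr1 ler_pM //.
apply: (le_trans (mx_norm_mul _ _)); rewrite -mulrA ler_wpM2l //.
by rewrite -[leRHS]mul1r ler_pM.
Qed.

Lemma geometric_sum_le (nu : R) m : 0 <= nu -> nu < 1 ->
  \sum_(k < m) nu ^+ k.+1 <= (1 - nu)^-1.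
Proof.
move=> nu0 nu1; have n1 : 0 < 1 - nu by rewrite subr_gt0.
have h : \sum_(k < m) nu ^+ k = (1 - nu ^+ m) / (1 - nu).
  have := subrX1 nu m => /eqP; rewrite -[_ == _]eqr_opp !opprB -mulNr opprB => /eqP ->.
  by field; rewrite gt_eqF.
under eq_bigr do rewrite exprS.
rewrite -mulr_sumr h mulrA ler_pdivrMr // mulVf ?gt_eqF //.
have : 0 <= nu * nu ^+ m by rewrite mulr_ge0 // exprn_ge0.
by rewrite mulrBr mulr1; lra.
Qed.

(* [ln A = ln c - sum_k (1 - A/c)^k / k] with [c] above the spectrum; in a basis
   where the central matrix is diagonal the row sums of the majorants of the
   polynomial matrix [1 - A/c] stay below some [nu < 1]. *)
Lemma analytic_mlog n (A0 W : Sym R n) (a : R) i j : SPD (A0 + a *: W) ->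
  analytic_at (fun s => symmx (mlog (A0 + s *: W : Sym R n)) i j) a.
Proof.
set A := A0 + a *: W => hA.
have [mu [d [mu0 d0 hmu]]] := eigenvalue_lower_bound hA.
have [U [e [oU eA]]] := Sym_spectral A.
have emu k : mu <= e 0 k by apply: (hmu A U e _ oU eA); rewrite subrr normr0.
pose T := U *m W *m U^T.
(* By [odiag_le_norm], an upper bound for the eigenvalues of [A + x W] when [|x| <= 1]; the added
   [mu + 1] ensures [mu / c < 1]. *)
pose c := n%:R * (n%:R * (`|A| + `|W|)) + mu + 1.
have c0' : 0 <= n%:R * (n%:R * (`|A| + `|W|)) by rewrite !mulr_ge0 ?addr_ge0.
have c0 : 0 < c by rewrite /c; lra.
have muc : mu < c by rewrite /c; lra.
pose t := \sum_k \sum_l `|T k l|.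
have t0 : 0 <= t by apply: sumr_ge0 => k _; exact: sumr_ge0.
(* Three demands: [r <= 1] for the bound by [c], [r |W| < d] for the lower bound [mu] on the
   eigenvalues, and [r t <= mu / 2], so that the perturbation uses up half of the room [mu / c] left
   by the diagonal of [1 - A / c]. *)
pose r := Num.min 1 (Num.min (d / (`|W| + 1) / 2) (mu / (t + 1) / 2)).
have W10 : 0 < `|W| + 1 by rewrite ltr_wpDl.
have t10 : 0 < t + 1 by rewrite ltr_wpDl.
have r0 : 0 < r by rewrite !lt_min ltr01 !divr_gt0.
have r1 : r <= 1 by rewrite ge_min lexx.
have rW : r * `|W| < d.
  have : r <= d / (`|W| + 1) / 2 by rewrite !ge_min lexx orbT.
  rewrite !ler_pdivlMr // => h; apply: (@le_lt_trans _ _ (r * (`|W| + 1))).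
    by rewrite ler_wpM2l ?(ltW r0) // lerDl.
  have : 0 < r * (`|W| + 1) by rewrite mulr_gt0.
  lra.
have rt : r * t <= mu / 2.
  have : r <= mu / (t + 1) / 2 by rewrite !ge_min lexx !orbT.
  by rewrite mulrAC ler_pdivlMr // mulrDr mulr1; lra.
pose nu := 1 - mu / c / 2.
have muc1 : mu / c < 1 by rewrite ltr_pdivrMr // mul1r.
have muc0 : 0 < mu / c by rewrite divr_gt0.
have nu0 : 0 <= nu by rewrite /nu; lra.
have nu1 : nu < 1 by rewrite /nu; lra.
(* The matrix [1 - (A + X W) / c] written in the eigenbasis [U] of [A]. *)
pose N : 'M[{poly R}]_n := \matrix_(k, l)
  (((1 - e 0 k / c) *+ (k == l))%:P - 'X * (T k l / c)%:P).
have hN k : \sum_l majorant r (N k l) <= nu.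
  apply: (@le_trans _ _ (\sum_l ((1 - e 0 k / c) *+ (k == l) + r * (`|T k l| / c)))).
    apply: ler_sum => l _; rewrite mxE; apply: (le_trans (majorantD _ _ (ltW r0))).
    rewrite majorantN majorantXM !majorantC normrM normfV (gtr0_norm c0) lerD2r.
    case: eqP => _; rewrite ?mulr1n ?mulr0n ?normr0 // ger0_norm // subr_ge0 ler_pdivrMr //.
    rewrite mul1r; apply: (le_trans (odiag_le_norm k oU eA)); rewrite /c.
    have : n%:R * (n%:R * `|A|) <= n%:R * (n%:R * (`|A| + `|W|)).
      by rewrite !ler_wpM2l // lerDl.
    lra.
  rewrite big_split /= (bigD1 k) //= eqxx mulr1n big1 ?addr0 => [|l lk]; last first.
    by rewrite eq_sym (negbTE lk) mulr0n.
  rewrite -mulr_sumr -mulr_suml.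
  have h1 : mu / c <= e 0 k / c by rewrite ler_pM2r ?invr_gt0.
  have h2 : r * ((\sum_l `|T k l|) / c) <= mu / c / 2.
    rewrite mulrA [leRHS]mulrAC ler_pM2r ?invr_gt0 //; apply: le_trans rt.
    rewrite ler_wpM2l ?(ltW r0) // /t [leRHS](bigD1 k) //= lerDl.
    by apply: sumr_ge0 => p _; exact: sumr_ge0.
  rewrite /nu; lra.
(* [G] is the cost of returning to the original basis. As [nu < 1], the geometric sum bounds the
   majorant independently of the truncation order [m]. *)
pose G := \sum_p \sum_q `|U p i * U q j|.
have G0 : 0 <= G by apply: sumr_ge0 => p _; exact: sumr_ge0.
exists r, (`|ln c| + G / (1 - nu)); split => // eps eps0.
have [m hm] : exists m, n%:R * ((1 - mu / c) ^+ m / (mu / c)) <= eps.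
  have h : (fun m => n%:R / (mu / c) * (1 - mu / c) ^+ m) @ \oo --> (n%:R / (mu / c) * 0 : R).
    by apply: cvgMl_tmp; apply: cvg_expr; rewrite ger0_norm; lra.
  have [m _ hm] := (cvgrPdist_lt _ _).1 h eps eps0; exists m.
  have := hm m (leqnn m); rewrite mulr0 sub0r normrN => /ltW; apply: le_trans.
  by rewrite mulrCA mulrC; exact: ler_norm.
pose S k : {poly R} := \sum_p \sum_q (U p i * U q j)%:P * (N ^+ k) p q.
have SG k : majorant r (S k) <= G * nu ^+ k.
  rewrite mulr_suml; apply: (le_trans (majorant_sum _ _ _ (ltW r0))).
  apply: ler_sum => p _; rewrite mulr_suml; apply: (le_trans (majorant_sum _ _ _ (ltW r0))).
  apply: ler_sum => q _; rewrite majorantZ ler_wpM2l //.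
  exact: majorant_mxX_entry (ltW r0) nu0 hN.
exists ((ln c *+ (i == j))%:P - \sum_(k < m) k.+1%:R^-1%:P * S k.+1); split.
  apply: (le_trans (majorantD _ _ (ltW r0))); rewrite majorantN majorantC.
  apply: lerD; first by case: eqP => _; rewrite ?mulr1n // mulr0n normr0.
  apply: (le_trans (majorant_sum _ _ _ (ltW r0))).
  apply: (@le_trans _ _ (\sum_(k < m) G * nu ^+ k.+1)).
    apply: ler_sum => k _; rewrite majorantZ; apply: le_trans (SG k.+1).
    rewrite ler_piMl ?majorant_ge0 ?(ltW r0) // normfV ger0_norm //.
    by rewrite invf_le1 // ler1n.
  by rewrite -mulr_sumr ler_wpM2l // geometric_sum_le.
move=> x xr; rewrite scalerDl addrA -/A.
set B := A + x *: W.
have BA : `|B - A| < d.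
  rewrite /B addrC addKr normrZ; apply: le_lt_trans rW.
  by rewrite ler_wpM2r.
have [V [b [oV eB]]] := Sym_spectral B.
have bmu k : mu <= b 0 k by exact: (hmu B V b).
have b0 k : 0 < b 0 k by exact: lt_le_trans mu0 (bmu k).
have bc k : b 0 k <= c.
  apply: (le_trans (odiag_le_norm k oV eB)); rewrite /c.
  have : n%:R * (n%:R * `|B|) <= n%:R * (n%:R * (`|A| + `|W|)).
    rewrite !ler_wpM2l //; apply: (le_trans (ler_normD _ _)).
    rewrite lerD2l normrZ ler_piMl //; exact: le_trans xr r1.
  lra.
pose y : 'rV[R]_n := const_mx 1 - c^-1 *: b.
have yE k : y 0 k = 1 - b 0 k / c by rewrite !mxE mulrC.
have hy : odiag V y = 1%:M - c^-1 *: symmx B.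
  rewrite eB -(odiag_const 1 oV) /odiag /y linearB linearZ /=.
  by rewrite mulmxBr mulmxBl -scalemxAr -scalemxAl.
have hNx : map_mx (horner_eval x) N = U *m odiag V y *m U^T.
  rewrite hy mulmxBr mulmxBl mulmx1 oU -scalemxAr -scalemxAl symmxD symmxZ eA.
  rewrite mulmxDr mulmxDl -scalemxAr -scalemxAl -/T /odiag !mulmxA oU mul1mx.
  rewrite -mulmxA oU mulmx1; apply/matrixP => k l.
  rewrite [LHS]mxE /horner_eval [N k l]mxE hornerD hornerN hornerM hornerX !hornerC.
  move: (T) => T'; rewrite !mxE.
  case: (k =P l) => [->|_]; rewrite ?mulr1n ?mulr0n; field; rewrite gt_eqF //.
have hS k : (S k).[x] = odiag V (map_mx (fun u => u ^+ k) y) i j.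
  rewrite -odiagX // -(conj_mxX _ _ oU) -hNx -map_mx_hornerX mxE horner_sum.
  under eq_bigr do rewrite horner_sum.
  rewrite exchange_big /=; apply: eq_bigr => q _; rewrite mxE mulr_suml.
  by apply: eq_bigr => p _; rewrite !mxE hornerCM /horner_eval mulrAC.
rewrite eB mlog_odiag //= hornerD hornerN hornerC horner_sum.
have -> : ln c *+ (i == j) = odiag V (const_mx (ln c)) i j.
  by rewrite odiag_const // mxE.
under [in X in _ - X]eq_bigr do rewrite hornerCM hS odiagE mulr_sumr.
rewrite exchange_big /= !odiagE -sumrB -sumrB.
apply: (le_trans (ler_norm_sum _ _ _)); apply: le_trans hm.
apply: (@le_trans _ _ (\sum_(l < n) (1 - mu / c) ^+ m / (mu / c))); last first.
  by rewrite sumr_const card_ord mulr_natl.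
apply: ler_sum => l _.
have V1 k : `|V l k| <= 1.
  apply: le_trans (norm_row_orthonormal l oV).
  by have := le_mx_norm (row l V) 0 k; rewrite mxE.
have bc0 : 0 < b 0 l / c by rewrite divr_gt0.
have bc1 : b 0 l / c <= 1 by rewrite ler_pdivrMr // mul1r.
have bcmu : mu / c <= b 0 l / c by rewrite ler_pM2r // invr_gt0.
(* In the eigenbasis of [A + x W] the error decouples into remainders of the scalar series at
   [b_l / c], which lies in [[mu / c, 1]]; hence [m] can be chosen uniformly in [x]. *)
rewrite (_ : _ - _ = (ln (b 0 l / c) +
  \sum_(k < m) k.+1%:R^-1 * (1 - b 0 l / c) ^+ k.+1) * (V l i * V l j)); last first.
  rewrite ln_div ?posrE // mulrDl mulr_suml !mxE opprB addrCA [LHS]addrC; congr (_ + _).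
    by rewrite mulrBl.
  by apply: eq_bigr => k _; rewrite mxE yE !mulrA.
rewrite !normrM -[leRHS]mulr1 ler_pM ?mulr_ge0 //.
  apply: (le_trans (ln_partial_sum m bc0 bc1)).
  rewrite ler_pM ?exprn_ge0 ?invr_ge0 ?subr_ge0 ?(ltW bc0) //.
    by rewrite lerXn2r ?nnegrE ?subr_ge0 ?(ltW muc1) // lerB.
  by rewrite lef_pV2 ?posrE.
by rewrite -[leRHS]mul1r ler_pM.
Qed.

End LogAnalytic.

(** * Null sets of the iterated Lebesgue measure *)

Section NullSets.
Context (R : realType).

Lemma countable_setU2 T (A B : set T) : countable A -> countable B -> countable (A `|` B).
Proof.
move=> cA cB; rewrite (_ : _ `|` _ = \bigcup_(b in [set: bool]) if b then A else B).
  by apply: bigcup_countable => // -[].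
apply/seteqP; split => [x [Ax|Bx]|x [[] _ ?]]; [by exists true|by exists false|by left|by right].
Qed.

(** A non-maximal point of [B] lies below a rational that is itself below a point of [B]; each such
    rational accounts for finitely many points, and at most one maximum remains. *)
Lemma countable_of_finite_below (B : set R) :
  (forall y, B y -> finite_set [set x | B x /\ x <= y]) -> countable B.
Proof.
move=> hB.
pose A (q : rat) := [set x | [/\ B x, x <= ratr q & exists2 y, B y & ratr q <= y]].
pose M := [set x | B x /\ forall y, B y -> y <= x].
have cA q : countable (A q).
  have [[y By qy]|nex] := pselect (exists2 y, B y & ratr q <= y).
    apply/finite_set_countable/(sub_finite_set _ (hB y By)) => x [Bx xq _].
    by split => //; exact: le_trans qy.
  by rewrite (_ : A q = set0) // -subset0 => x [_ _] /nex.
have cM : countable M.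
  have [[x [Bx mx]]|nex] := pselect (exists x, M x).
    apply/finite_set_countable/(sub_finite_set _ (finite_set1 x)) => z [Bz mz].
    by apply/eqP; rewrite eq_le mz // mx.
  by rewrite (_ : M = set0) // -subset0 => x Mx; apply: nex; exists x.
apply: (@sub_countable _ _ _ (\bigcup_q A q `|` M)); last first.
  by apply: countable_setU2 => //; exact: bigcup_countable.
apply: subset_card_le => x Bx; have [mx|nm] := pselect (forall y, B y -> y <= x).
  by right.
left; have [y By xy] : exists2 y, B y & x < y.
  apply: contrapT => ne; apply: nm => y By; rewrite leNgt; apply/negP => xy.
  by apply: ne; exists y.
have [q] := rat_in_itvoo xy; rewrite in_itv /= => /andP[xq qy].
by exists q => //; split => //; [exact: ltW|exists y => //; exact: ltW].
Qed.

Lemma countable_of_finite_segments (B : set R) (a : R) :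
  (forall y, B y ->
     finite_set [set x | B x /\ exists2 s, 0 <= s <= 1 & x = a + s * (y - a)]) ->
  countable B.
Proof.
move=> hB.
have seg x y : a <= x -> x <= y -> exists2 s, 0 <= s <= 1 & x = a + s * (y - a).
  move=> ax xy; have [ya|ya] := eqVneq y a.
    by exists 0; rewrite ?lexx ?ler01 // mul0r addr0; apply/eqP; rewrite eq_le ax -ya xy.
  have ay : 0 < y - a by rewrite subr_gt0 lt_def ya (le_trans ax).
  exists ((x - a) / (y - a)); last by rewrite divfK ?gt_eqF // addrC subrK.
  by rewrite divr_ge0 ?(ltW ay) ?subr_ge0 //= ler_pdivrMr // mul1r lerB.
have seg' x y : y <= x -> x <= a -> exists2 s, 0 <= s <= 1 & x = a + s * (y - a).
  move=> yx xa; have [ya|ya] := eqVneq y a.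
    by exists 0; rewrite ?lexx ?ler01 // mul0r addr0; apply/eqP; rewrite eq_le xa -ya yx.
  have ay : 0 < a - y by rewrite subr_gt0 lt_def eq_sym ya (le_trans yx).
  exists ((a - x) / (a - y)); last first.
    by rewrite -(opprB a y) mulrN divfK ?gt_eqF // opprB addrC subrK.
  by rewrite divr_ge0 ?(ltW ay) ?subr_ge0 //= ler_pdivrMr // mul1r lerB.
have cr : countable (B `&` [set x | a <= x]).
  apply: countable_of_finite_below => y [By ay].
  apply: (sub_finite_set _ (hB y By)) => x [[Bx ax] xy]; split => //; exact: seg.
have cl : countable [set x | B (- x) /\ - x <= a].
  apply: countable_of_finite_below => y [By ay].
  apply: (sub_finite_set _ (finite_image (fun x => - x) (hB _ By))) => x [[Bx xa] xy].
  by exists (- x); rewrite ?opprK //; split => //; apply: seg' => //; rewrite lerN2.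
apply: (@sub_countable _ _ _ ((B `&` [set x | a <= x]) `|`
   ((fun x => - x) @` [set x | B (- x) /\ - x <= a]))); last first.
  by apply: countable_setU2 => //; exact: card_le_trans (card_image_le _ _) cl.
apply: subset_card_le => x Bx; have [ax|xa] := leP a x; [by left|right].
by exists (- x); rewrite /= ?opprK //; split => //; exact: ltW.
Qed.

(** Measurability comes for free: the preimage of a set missing [0] is countable, and that of a set
    containing [0] has countable complement. *)
Lemma integral_countable_support (f : R -> \bar R) (B : set R) : countable B ->
  (forall x, ~ B x -> f x = 0%E) -> (\int[lebesgue_measure]_x f x = 0)%E.
Proof.
move=> cB f0.
have mB (A : set R) : countable A -> measurable A.
  by apply: countable_measurable => t; exact: measurable_set1.
have mf : measurable_fun setT (f : measurableTypeR R -> \bar R).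
  move=> _ Y mY; rewrite setTI; have [Y0|Y0] := pselect (Y 0%E).
    rewrite -[X in measurable X]setCK; apply: measurableC; apply: mB.
    apply: sub_countable cB; apply: subset_card_le => x nYf; apply: contrapT => nBx.
    by apply: nYf; rewrite /= f0.
  apply: mB; apply: sub_countable cB; apply: subset_card_le => x Yf.
  by apply: contrapT => nBx; apply: Y0; rewrite -(f0 x).
rewrite (@ae_eq_integral _ _ _ lebesgue_measure setT (cst 0%E)) ?integral0 //.
exists B; split; [exact: mB|exact: countable_lebesgue_measure0|].
by move=> x /= h; apply: contrapT => nBx; apply: h => _; exact: f0.
Qed.

Definition tuple_line k (a b : k.-tuple R) (s : R) : k.-tuple R :=
  [tuple tnth a i + s * (tnth b i - tnth a i) | i < k].

Lemma tuple_line_cons k (x y : R) (a b : k.-tuple R) s :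
  tuple_line [tuple of x :: a] [tuple of y :: b] s =
  [tuple of (x + s * (y - x)) :: tuple_line a b s].
Proof.
apply: eq_from_tnth => i; rewrite tnth_mktuple; case: (unliftP ord0 i) => [j|] ->.
  by rewrite !tnthS tnth_mktuple.
by rewrite !tnth0.
Qed.

(* Induction on the dimension: the first coordinates of the slices of [U] that lie
   entirely in [Z] form a countable set, since a segment of [U] from a point outside
   [Z] meets [Z] in finitely many points. *)
Lemma lebesgue_null_of_lines k (U Z : set (k.-tuple R)) :
  (forall a b s, U a -> U b -> 0 <= s <= 1 -> U (tuple_line a b s)) ->
  Z `<=` U ->
  (forall a b, U a -> ~ Z a -> U b ->
     finite_set [set s | 0 <= s <= 1 /\ Z (tuple_line a b s)]) ->
  (forall a, U a -> exists2 b, U b & ~ Z b) ->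
  lebesgue Z = 0%E.
Proof.
elim: k U Z => [|k IH] U Z Uconv ZU hline ne /=.
  rewrite diracE memNset // => Z0; have [b _ nZb] := ne _ (ZU _ Z0).
  by apply: nZb; rewrite (tuple0 b).
have [[a0 Ua0]|nU] := pselect (exists a, U a); last first.
  apply: (@integral_countable_support _ set0) => // x _.
  apply: (IH set0) => // t Zt; apply: nU; eexists; exact: ZU Zt.
have [a Ua nZa] := ne _ Ua0.
pose B := [set x | (exists t : k.-tuple R, U [tuple of x :: t]) /\
  forall t : k.-tuple R, U [tuple of x :: t] -> Z [tuple of x :: t]].
apply: (@integral_countable_support _ B).
  (* Each [y] in [B] supplies an endpoint in [U]. By convexity the segment point with first
     coordinate [x] lies in [U], and [x] in [B] puts it in [Z], so finitely many parameters
     occur. *)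
  apply: (@countable_of_finite_segments _ (thead a)) => y [[t Ut] _].
  have fin := hline a _ Ua nZa Ut.
  apply: (sub_finite_set _ (finite_image (fun s => thead a + s * (y - thead a)) fin)).
  move=> x [[_ Bx] [s s01 xs]]; exists s => //; split => //.
  have := Uconv _ _ _ Ua Ut s01.
  by rewrite [a]tuple_eta tuple_line_cons -xs; exact: Bx.
move=> x nBx; apply: (IH [set t : k.-tuple R | U [tuple of x :: t]]
  [set t : k.-tuple R | Z [tuple of x :: t]]).
- move=> b c s Ub Uc s01; have := Uconv _ _ _ Ub Uc s01.
  by rewrite tuple_line_cons subrr mulr0 addr0.
- by move=> t /= Zt; exact: ZU.
- move=> b c Ub nZb Uc; apply: (sub_finite_set _ (hline _ _ Ub nZb Uc)) => s [s01 Zs].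
  by split => //; rewrite tuple_line_cons subrr mulr0 addr0.
- move=> b Ub; apply: contrapT => h; apply: nBx; split; first by exists b.
  by move=> t Ut; apply: contrapT => nZt; apply: h; exists t.
Qed.

(** [O] is a countable union of cubes with rational centres and radii [1 / (j + 1)]; a radius below
    [e / 2] keeps a cube containing [t] within distance [e] of [t]. *)
Lemma measurable_open_tuple k (O : set (k.-tuple R)) :
  (forall t, O t -> exists2 e, 0 < e &
     forall t', (forall i, `|tnth t' i - tnth t i| < e) -> O t') ->
  measurable O.
Proof.
move=> hO.
pose box (p : k.-tuple rat * nat) : set (k.-tuple R) :=
  [set t | forall i, `|tnth t i - ratr (tnth p.1 i)| < p.2.+1%:R^-1].
have mbox p : measurable (box p).
  have -> : box p = \bigcap_(i in [set: 'I_k])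
      ((@tnth _ R ^~ i) @^-1` ball (ratr (tnth p.1 i) : R) (p.2.+1%:R^-1)).
    apply/seteqP; split => t /= h i; first by move=> _; rewrite /ball /= distrC; exact: h.
    by have := h i I; rewrite /ball /= distrC.
  apply: fin_bigcap_measurable => [|i _]; first exact: finite_finset.
  rewrite -[X in measurable X]setTI; apply: measurable_tnth => //.
  exact: measurable_ball.
pose F p := if `[< box p `<=` O >] then box p else set0.
have -> : O = \bigcup_p F p.
  apply/seteqP; split => t; last first.
    by move=> [p _]; rewrite /F; case: asboolP => // h; exact: h.
  move=> Ot; have [e e0 he] := hO t Ot.
  have [j hj] := ltr_add_invr (divr_gt0 e0 (ltr0n R 2)); rewrite add0r in hj.
  have j0 : 0 < j.+1%:R^-1 :> R by rewrite invr_gt0.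
  have hq i : exists q : rat, `|tnth t i - ratr q| < j.+1%:R^-1.
    have [|q] := @rat_in_itvoo R (tnth t i) (tnth t i + j.+1%:R^-1).
      by rewrite ltrDl.
    rewrite in_itv /= => /andP[h1 h2]; exists q.
    by rewrite distrC ger0_norm ?subr_ge0 ?(ltW h1) // ltrBlDl.
  have /fin_all_exists[q hq'] := hq.
  have bt : box ([tuple q i | i < k], j) t by move=> i; rewrite tnth_mktuple.
  exists ([tuple q i | i < k], j) => //; rewrite /F; case: asboolP => // -[] t' bt'.
  apply: he => i; have := bt i; have := bt' i; rewrite /= => h1 h2.
  rewrite -(subrK (ratr (tnth [tuple q i | i < k] i)) (tnth t' i)) -addrA.
  apply: (le_lt_trans (ler_normD _ _)); rewrite [`|ratr _ - _|]distrC.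
  by apply: (lt_trans (ltrD h1 h2)); rewrite [e in _ < e]splitr ltrD.
apply: countable_bigcupT_measurable => [|p]; first exact: countableP.
by rewrite /F; case: asboolP.
Qed.

End NullSets.

(** * The singular set *)

Section LogGram.
Context (R : realType) (n l : nat) (Rs : 'I_l -> Sym R n).
Hypothesis Rs_spd : forall i, SPD (Rs i).
Implicit Types P Q : Sym R n.

Definition log_coord (L : 'I_l -> 'M[R]_n) : 'M[R]_(l, symdim n) :=
  \matrix_(i, k) L i (uidx k).1 (uidx k).2.

(** The product is taken as [M^T M] because [M M^T] is singular as soon as [l > symdim n]. If it is
    invertible, [w = (w (M^T M)^-1 M^T) M] expresses any [w] through the rows of [M]; if it kills
    [v], then [v] is orthogonal to all rows, hence to itself when they span. *)
Lemma full_rank_gram P : let M := log_coord (fun i => riem_log P (Rs i)) in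
  (log_rank Rs P < symdim n)%N = (\det (M^T *m M) == 0).
Proof.
move=> M; pose t := [tuple riem_log P (Rs i) | i < l].
have rowM i : row i M = symcoord (riem_log P (Rs i)) by apply/rowP => k; rewrite !mxE.
have coordE (c : 'I_l -> R) :
    symcoord (\sum_i c i *: riem_log P (Rs i)) = (\row_i c i) *m M.
  apply/rowP => k; rewrite !mxE (big_morph (@symmx R n) (@symmxD R n) erefl) summxE.
  by apply: eq_bigr => i _; rewrite symmxZ !mxE.
have le : (log_rank Rs P <= symdim n)%N by rewrite /log_rank -(dim_Sym R n) dimvS ?subvf.
rewrite ltnNge; apply/idP/idP => [|/det0P[v v0 vM]].
  apply: contraNT => d0; have uM : M^T *m M \in unitmx by rewrite unitmxE unitfE.
  rewrite -(dim_Sym R n) dimvS //; apply/subvP => W _.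
  pose u := symcoord W *m invmx (M^T *m M) *m M^T.
  have -> : W = \sum_i u 0 i *: riem_log P (Rs i).
    apply: (can_inj (@symcoordK R n)); rewrite coordE.
    rewrite (_ : \row_i u 0 i = u); last by apply/rowP => i; rewrite mxE.
    by rewrite /u -(mulmxA _ M^T) mulmxKV.
  apply: memv_suml => i _; apply: memvZ; apply: memv_span.
  by apply/tnthP; exists i; rewrite tnth_mktuple.
apply/negP => ge.
have vMt : v *m M^T = 0.
  apply/eqP; rewrite -dotmx_eq0 trmx_mul trmxK mulmxA -(mulmxA v) vM mul0mx.
  by rewrite mxE.
have full : (fullv <= <<t>>)%VS.
  by rewrite -(dimv_leqif_sup (subvf _)) eqn_leq dimvS ?subvf //= dim_Sym.
have VE := coord_span (subvP full (symcoord_inv v) (memvf _)).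
have vE : v = (\row_i coord t i (symcoord_inv v)) *m M.
  rewrite -coordE -[LHS]symcoord_invK {1}VE; congr symcoord.
  by apply: eq_bigr => i _; rewrite -tnth_nth tnth_mktuple.
case/eqP: v0; apply/eqP; rewrite -dotmx_eq0 {1}vE -mulmxA -[M *m v^T]trmxK.
by rewrite trmx_mul trmxK vMt trmx0 mulmx0 mxE.
Qed.

(** The right-hand side of [riem_logE], which agrees with [riem_log P (Rs i)] on [SPD]; it contains
    no [msqrt P]. *)
Definition log_formula P i : 'M[R]_n :=
  - (P *m invmx (msqrt (Rs i)) *m mlog (whiten (Rs i) P) *m msqrt (Rs i)).

Definition gram_det P : R :=
  \det ((log_coord (log_formula P))^T *m log_coord (log_formula P)).

Lemma log_singularE P : log_singular Rs P <-> SPD P /\ gram_det P = 0.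
Proof.
have h : SPD P -> (log_rank Rs P < symdim n)%N = (gram_det P == 0).
  move=> hP; rewrite full_rank_gram /gram_det.
  by congr (\det (_^T *m _) == 0); apply/matrixP => i k; rewrite [LHS]mxE [RHS]mxE riem_logE.
split=> -[hP]; first by rewrite h // => /eqP g0.
by move=> g0; split => //=; rewrite h // g0.
Qed.

Lemma log_regularE P : log_regular Rs P <-> SPD P /\ gram_det P != 0.
Proof.
split=> [[hP ns]|[hP g0]]; split => //.
  by apply/eqP => g0; apply: ns; apply/log_singularE.
by move=> /log_singularE[_ /eqP]; apply/negP.
Qed.

Lemma SPD_setD_log_regular : @SPD R n `\` log_regular Rs = log_singular Rs.
Proof.
apply/seteqP; split => P.
  by move=> [hP nP]; apply: contrapT => ns; apply: nP.
by move=> sP; split; [have [] := sP|move=> [_]; apply].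
Qed.

Lemma SPD_segment P Q (s : R) : SPD P -> SPD Q -> 0 <= s <= 1 -> SPD (P + s *: (Q - P)).
Proof.
move=> hP hQ /andP[s0 s1] v v0.
have -> : (v *m symmx (P + s *: (Q - P)) *m v^T) 0 0 =
    (1 - s) * (v *m P *m v^T) 0 0 + s * (v *m Q *m v^T) 0 0.
  rewrite symmxD symmxZ symmxB !(mulmxDr, mulmxDl, mulmxBr, mulmxBl).
  by rewrite -scalemxAr -scalemxAl mulmxBr mulmxBl; rewrite !mxE; ring.
have p := hP v v0; have q := hQ v v0.
have [->|s1'] := eqVneq s 1; first by rewrite subrr mul0r add0r mul1r.
by rewrite ltr_pwDl ?mulr_ge0 ?(ltW q) // mulr_gt0 // subr_gt0 lt_def eq_sym s1'.
Qed.

Lemma analytic_gram_det P Q (a : R) : SPD (P + a *: Q) ->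
  analytic_at (fun s => gram_det (P + s *: Q)) a.
Proof.
move=> ha.
have coordP i j : analytic_at (fun s => symmx (P + s *: Q) i j) a.
  under eq_fun do rewrite symmxD symmxZ !mxE; exact: analytic_affine.
have constC m k (C : 'M[R]_(m, k)) i j : analytic_at (fun=> C i j) a by exact: analytic_cst.
have formula r i j : analytic_at (fun s => log_formula (P + s *: Q) r i j) a.
  rewrite /log_formula; under eq_fun do rewrite mxE -mulN1r.
  apply: analyticM; first exact: analytic_cst.
  apply: (analytic_mulmx (M := fun s => _) (N := fun=> _)) => // {i j} i j.
  apply: (analytic_mulmx (M := fun s => _) (N := fun s => _)) => {i j} i j.
    by apply: (analytic_mulmx (M := fun s => _) (N := fun=> _)).
  under eq_fun do rewrite linearD linearZ.
  apply: analytic_mlog; rewrite -linearZ -linearD; exact: SPD_whiten.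
have analyticM' i k : analytic_at (fun s => log_coord (log_formula (P + s *: Q)) i k) a.
  by under eq_fun do rewrite mxE; exact: formula.
apply: (analytic_det (M := fun s => _)) => i j.
apply: (analytic_mulmx (M := fun s => _) (N := fun s => _)) => // {i j} i j.
by under eq_fun do rewrite mxE; exact: analyticM'.
Qed.

Lemma gram_det_finite_zeros P Q : SPD P -> SPD Q -> gram_det P != 0 ->
  finite_set [set s : R | 0 <= s <= 1 /\ gram_det (P + s *: (Q - P)) = 0].
Proof.
move=> hP hQ g0; apply: analytic_finite_zeros => [a a01|]; last by rewrite scale0r addr0.
by apply: analytic_gram_det; exact: SPD_segment.
Qed.

Lemma cvg_mulmx_entries m k p (F : set_system (Sym R n)) {FF : Filter F}
    (M : Sym R n -> 'M[R]_(m, k)) (N : Sym R n -> 'M[R]_(k, p))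
    (A : 'M[R]_(m, k)) (B : 'M[R]_(k, p)) :
  (forall i j, (fun x => M x i j) @ F --> (A i j : R)) ->
  (forall i j, (fun x => N x i j) @ F --> (B i j : R)) ->
  forall i j, (fun x => (M x *m N x) i j) @ F --> ((A *m B) i j : R).
Proof.
move=> hM hN i j; rewrite mxE; under eq_fun do rewrite mxE.
apply: cvg_big => [|r _]; first exact: add_continuous.
by apply: cvgM.
Qed.

Lemma cvg_det_entries k (F : set_system (Sym R n)) {FF : Filter F}
    (M : Sym R n -> 'M[R]_k) (A : 'M[R]_k) :
  (forall i j, (fun x => M x i j) @ F --> (A i j : R)) ->
  (fun x => \det (M x)) @ F --> \det A.
Proof.
move=> hM; apply: cvg_big => [|s _]; first exact: add_continuous.
apply: cvgM; first exact: cvg_cst.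
by apply: cvg_big => [|i _]; first exact: mul_continuous.
Qed.

(** Analyticity along lines does not yield joint continuity, so the local Lipschitz bound on [mlog]
    is used instead. The result makes the regular set open and the singular set measurable. *)
Lemma cvg_gram_det (F : set_system (Sym R n)) {FF : Filter F} P : SPD P ->
  (forall e, 0 < e -> F [set X | `|P - X| < e]) -> gram_det @ F --> gram_det P.
Proof.
move=> hP hF.
have cP i j : (fun X : Sym R n => symmx X i j) @ F --> (symmx P i j : R).
  apply/cvgrPdist_lt => e e0; apply: filterS (hF e e0) => X /=.
  apply: le_lt_trans; have := le_mx_norm (symmx (P - X)) i j.
  by rewrite symmxB !mxE.
have cC m k (C : 'M[R]_(m, k)) i j : (fun=> C i j) @ F --> (C i j : R) by exact: cvg_cst.
have cln r i j : (fun X => symmx (mlog (whiten (Rs r) X)) i j) @ F -->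
    (symmx (mlog (whiten (Rs r) P)) i j : R).
  have [C [d [C0 d0 h]]] := mlog_lipschitz_at (SPD_whiten (Rs_spd r) hP).
  have [c c0 hc] := whiten_bounded (Rs r).
  apply/cvgrPdist_lt => e e0.
  (* [d / c] keeps the whitened points inside the Lipschitz ball; the second bound makes
     [C * c * |X - P|] smaller than [e]. *)
  have m0 : 0 < Num.min (d / c) (e / (C * c + 1)).
    by rewrite lt_min !divr_gt0 // ltr_wpDl // mulr_ge0 // ltW.
  apply: filterS (hF _ m0) => X /=; rewrite distrC lt_min => /andP[Xd Xe].
  have e1 : whiten (Rs r) X - whiten (Rs r) P = whiten (Rs r) (X - P) by rewrite linearB.
  rewrite distrC; apply: (@le_lt_trans _ _ (C * (c * `|X - P|))).
    have h1 : `|whiten (Rs r) X - whiten (Rs r) P| < d.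
      by rewrite e1; apply: le_lt_trans (hc _) _; rewrite mulrC -ltr_pdivlMr.
    apply: (@le_trans _ _ (C * `|whiten (Rs r) X - whiten (Rs r) P|)); last first.
      by rewrite ler_wpM2l // e1.
    apply: le_trans (h _ h1).
    have := le_mx_norm (symmx (mlog (whiten (Rs r) X) - mlog (whiten (Rs r) P))) i j.
    by rewrite symmxB !mxE.
  move: Xe; rewrite ltr_pdivlMr ?ltr_wpDl ?mulr_ge0 ?(ltW c0) //.
  by apply: le_lt_trans; rewrite mulrA mulrC ler_wpM2l // lerDl.
have cL r i j : (fun X => log_formula X r i j) @ F --> (log_formula P r i j : R).
  rewrite [X in _ --> X]mxE; under eq_fun do rewrite mxE; apply: cvgN.
  apply: (cvg_mulmx_entries (M := fun s => _) (N := fun=> _)) => // {i j} i j.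
  apply: (cvg_mulmx_entries (M := fun s => _) (N := fun s => _)) => // {i j} i j.
  by apply: (cvg_mulmx_entries (M := fun s => _) (N := fun=> _)).
have cM i k : (fun X => log_coord (log_formula X) i k) @ F --> (log_coord (log_formula P) i k : R).
  by rewrite mxE; under eq_fun do rewrite mxE; exact: cL.
apply: (cvg_det_entries (M := fun s => _)) => i j.
apply: (cvg_mulmx_entries (M := fun s => _) (N := fun s => _)) => // {i j} i j.
by rewrite mxE; under eq_fun do rewrite mxE; exact: cM.
Qed.

Lemma open_log_regular : open (log_regular Rs).
Proof.
rewrite openE => P /log_regularE[hP g0].
have hSPD : \forall X \near P, SPD X by exact: open_nbhs_nbhs (conj (@SPD_open R n) hP).
have FP : Filter (nbhs P) by exact: nbhs_filter.
have hg : \forall X \near P, gram_det X != 0.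
  have cg : gram_det @ nbhs P --> gram_det P.
    by apply: cvg_gram_det => // e e0; apply/nbhs_normP; exists e.
  exact: (@cvgr_neq0 _ _ _ _ _ _ _ cg g0).
apply: filterS2 hSPD hg => X hX gX; exact/log_regularE.
Qed.

Definition tuple_sym (t : (symdim n).-tuple R) : Sym R n :=
  symcoord_inv (\row_k tnth t k).

Lemma tuple_sym_line a b s :
  tuple_sym (tuple_line a b s) = tuple_sym a + s *: (tuple_sym b - tuple_sym a).
Proof.
suff e : symmx (tuple_sym (tuple_line a b s)) =
    symmx (tuple_sym a) + s *: (symmx (tuple_sym b) - symmx (tuple_sym a)) by exact: val_inj.
by apply/matrixP => i j; rewrite !mxE tnth_mktuple.
Qed.

Lemma image_symcoord (A : set (Sym R n)) :
  [set t | exists2 P, A P & t = [tuple symcoord P 0 k | k < symdim n]] = tuple_sym @^-1` A.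
Proof.
apply/seteqP; split => t /=.
  move=> [P AP ->]; rewrite /tuple_sym (_ : \row_k _ = symcoord P) ?symcoordK //.
  by apply/rowP => k; rewrite mxE tnth_mktuple.
move=> At; exists (tuple_sym t) => //; apply: eq_from_tnth => k.
by rewrite tnth_mktuple symcoord_invK mxE.
Qed.

Lemma measurable_open_Sym (O : set (Sym R n)) : open O -> measurable (tuple_sym @^-1` O).
Proof.
rewrite openE => hO; apply: measurable_open_tuple => t /hO /nbhs_normP[e e0 he].
exists e => // t' ht; apply: he => /=; rewrite /ball_ /= distrC Sym_normE.
apply: mx_norm_lt => // i j; rewrite symmxB !mxE; exact: ht.
Qed.

Lemma lebesgue_null_log_singular : (exists2 Q, SPD Q & log_rank Rs Q = symdim n) ->
  lebesgue_null (log_singular Rs).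
Proof.
move=> [Q hQ rQ].
have gQ : gram_det Q != 0.
  apply/eqP => g0; have /log_singularE[] : SPD Q /\ gram_det Q = 0 by [].
  by rewrite rQ ltnn.
(* Negligibility asks for a measurable null cover; the singular set itself serves, being a
   difference of two open sets. *)
rewrite /lebesgue_null image_symcoord; exists (tuple_sym @^-1` log_singular Rs); split => //.
  rewrite -SPD_setD_log_regular.
  exact: (measurableD (measurable_open_Sym (@SPD_open R n)) (measurable_open_Sym open_log_regular)).
apply: (@lebesgue_null_of_lines _ _ (tuple_sym @^-1` @SPD R n)).
- move=> a b s /= ha hb s01; rewrite tuple_sym_line; exact: SPD_segment.
- by move=> t [].
- move=> a b /= ha nZa hb.
  have ga : gram_det (tuple_sym a) != 0.
    by apply/eqP => g0; apply: nZa; apply/log_singularE.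
  apply: (sub_finite_set _ (gram_det_finite_zeros ha hb ga)) => s [s01].
  by rewrite /= tuple_sym_line => /log_singularE[_ ?].
- move=> a _; exists [tuple symcoord Q 0 k | k < symdim n].
    have : [set t | exists2 P, SPD P & t = [tuple symcoord P 0 k | k < symdim n]]
      [tuple symcoord Q 0 k | k < symdim n] by exists Q.
    by rewrite image_symcoord.
  have e : tuple_sym [tuple symcoord Q 0 k | k < symdim n] = Q.
    rewrite /tuple_sym (_ : \row_k _ = symcoord Q) ?symcoordK //.
    by apply/rowP => k; rewrite mxE tnth_mktuple.
  by rewrite /= e => -[_]; rewrite rQ ltnn.
Qed.

End LogGram.

Theorem theorem4 (R : realType) (n l : nat) (n_ge1 : (1 <= n)%N)
    (l_ge : (symdim n <= l)%N) (Rs : 'I_l -> Sym R n)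
    (Rs_spd : forall i : 'I_l, SPD (Rs i))
    (spanning : exists2 Q : Sym R n, SPD Q & log_rank Rs Q = symdim n) :
  [/\ lebesgue_null (log_singular Rs),
      open (log_regular Rs),
      forall P : Sym R n, log_regular Rs P ->
        locally_invertible_at (dist_map Rs) P
    & lebesgue_null (@SPD R n `\` log_regular Rs)].
Proof.
have null : lebesgue_null (log_singular Rs) by exact: lebesgue_null_log_singular.
split => //; first exact: open_log_regular.
  by move=> P; exact: locally_invertible_regular.
by rewrite SPD_setD_log_regular.
Qed.
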